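(* Let $\nu$ be a real number with $\nu>-1$ and let $r_\nu:\mathbb{D}\to\mathbb{C}$ be the normalized Dini function defined by $$r_{\nu}(z)=2^{\nu}\Gamma(\nu+1)z^{1-\frac{\nu}{2}}\left((1-\nu)J_{\nu}(\sqrt{z})+\sqrt{z}J_{\nu}'(\sqrt{z})\right)=\sum_{n\geq0}\frac{(-1)^n(2n+1)\Gamma(\nu+1)z^{n+1}}{4^n\,n!\,\Gamma(\nu+n+1)}.$$ The function $r_\nu$ is starlike in $\mathbb{D}$ and all of its derivatives $r_\nu^{(k)}$, $k\geq1$, are close-to-convex (and hence univalent) in $\mathbb{D}$ if and only if $\nu\geq\nu^\star$, where $\nu^\star\simeq0.3062\dots$ is the unique root of the equation $$J_{\nu}(1)-(3-2\nu)J_{\nu+1}(1)=0$$ (in the unknown $\nu$) on $(0,\infty)$.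
   Context: $\mathbb{D}=\{z\in\mathbb{C}:|z|<1\}$ is the open unit disk. $J_\nu$ is the Bessel function of the first kind of order $\nu$, $J_\nu(z)=\sum_{n\ge0}\frac{(-1)^n}{n!\,\Gamma(\nu+n+1)}\left(\frac z2\right)^{2n+\nu}$, and $J_\nu'$ is its derivative with respect to $z$. The expression with $\sqrt z$ and $z^{1-\nu/2}$ is understood as the single-valued function given by the displayed power series (which is entire). Starlike means univalent on $\mathbb{D}$ with image starlike with respect to the origin. An analytic function $g$ on $\mathbb{D}$ (no normalization required) is close-to-convex if there is a convex univalent function $h$ on $\mathbb{D}$ (not necessarily normalized) with $\operatorname{Re}(g'(z)/h'(z))>0$ for all $z\in\mathbb{D}$.
   Formalization: The displayed digits 0.3062… of ν* are not correct (the root is about 0.30608, since the equation's left side is already positive at 0.3062); the formal theorem states instead that |ν* − 0.3062| < 0.0002. *)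

(* Defs.v *)
(* Stdlib reals with Coquelicot. *)
From Stdlib Require Import Reals Arith.
From Coquelicot Require Import Coquelicot.
Open Scope R_scope.

(* Euler's integral of the second kind; only meaningful for 0 < x. *)
Definition Gamma (x : R) : R :=
  RInt_gen (fun t : R => Rpower t (x - 1) * exp (- t))
           (at_right 0) (Rbar_locally p_infty).

(* Only meaningful for -1 < nu (so that every Gamma argument is positive) and
   0 < x (so that [Rpower] is the real power). *)
Definition bessel_J (nu x : R) : R :=
  Series (fun n : nat =>
    (-1) ^ n / (INR (fact n) * Gamma (nu + INR n + 1))
      * Rpower (x / 2) (2 * INR n + nu)).

Definition dini_coef (nu : R) (n : nat) : R :=
  (-1) ^ n * (2 * INR n + 1) * Gamma (nu + 1)
    / (4 ^ n * INR (fact n) * Gamma (nu + INR n + 1)).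

(* The entire function given by the sum of the power series, which is how
   2^nu Gamma(nu+1) z^(1-nu/2) ((1-nu) J_nu(sqrt z) + sqrt z J_nu'(sqrt z))
   is understood as a single-valued function. *)
Definition dini_r (nu : R) (z : C) : C :=
  iota (fun l : C_CompleteNormedModule =>
    is_series (fun n : nat => (RtoC (dini_coef nu n) * z ^ (S n))%C) l).

(* [C_derive] takes the limit along the real direction only; it is the complex
   derivative wherever the function is complex differentiable. *)
Fixpoint C_derive_n (f : C -> C) (k : nat) : C -> C :=
  match k with
  | O => f
  | S k' => C_derive (C_derive_n f k')
  end.

Definition unit_disk (z : C) : Prop := Cmod z < 1.

(* The ring of scalars is C, so this is complex differentiability. *)
Definition analytic_on_disk (f : C -> C) : Prop :=
  forall z : C, unit_disk z -> @ex_derive C_AbsRing C_NormedModule f z.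

Definition univalent (f : C -> C) : Prop :=
  analytic_on_disk f /\
  forall z w : C, unit_disk z -> unit_disk w -> f z = f w -> z = w.

Definition disk_image (f : C -> C) (w : C) : Prop :=
  exists z : C, unit_disk z /\ f z = w.

Definition starlike_set (A : C -> Prop) : Prop :=
  forall (w : C) (t : R), A w -> 0 <= t <= 1 -> A (RtoC t * w)%C.

Definition convex_set (A : C -> Prop) : Prop :=
  forall (w1 w2 : C) (t : R), A w1 -> A w2 -> 0 <= t <= 1 ->
    A (RtoC (1 - t) * w1 + RtoC t * w2)%C.

Definition starlike (f : C -> C) : Prop :=
  univalent f /\ starlike_set (disk_image f).

Definition convex_univalent (f : C -> C) : Prop :=
  univalent f /\ convex_set (disk_image f).

(* Division by zero yields 0 in C, so the strict inequality also forces
   h'(z) <> 0. *)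
Definition close_to_convex (g : C -> C) : Prop :=
  analytic_on_disk g /\
  exists h : C -> C, convex_univalent h /\
    forall z : C, unit_disk z -> 0 < Re (C_derive g z / C_derive h z)%C.

(* Main.v *)
Require Import Defs.
From Stdlib Require Import Reals Ranalysis5 Arith Lra Lia Psatz FunctionalExtensionality.
From Coquelicot Require Import Coquelicot.
Open Scope R_scope.

(** Write r(z) = z P(z) with P(z) = sum p_n z^n, so that r' = Q with Q(z) = sum q_n z^n and
    q_n = (n + 1) p_n; here p_0 = 1 and p_1 < 0.  Everything is governed by the one number
    Q(1) = r'(1).  Splitting (n + 1) (2 n + 1) by means of the recurrence of the Bessel
    coefficients shows that J_nu(1) - (3 - 2 nu) J_(nu+1)(1) is a positive multiple of it
    ([bessel_combination]), and (nu + 1) r'(1) differs from nu by a function of nu with Lipschitz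
    constant at most 45/64 ([scaled_slope_near_identity]).  It therefore increases strictly and
    continuously on (-1, oo), with one zero nustar, located by truncating the series; so nustar <= nu
    means exactly that r'(1) >= 0.

    Necessity: r is real on [0, 1], with r(0) = 0 and r'(0) = 1.  If r'(1) < 0, its graph rises and
    later falls, so r takes some value twice in [0, 1) ([univalent_derivative_at_1]).

    Sufficiency does not go through the zeros of r; the coefficients decrease so fast that linear
    terms dominate.
    - In a derivative r^(k), k >= 1, the linear coefficient g_1 exceeds the sum of n |g_n| over
      n >= 2.  This makes it injective on the disc, and keeps the real part of r^(k+1) / g_1
      positive, so that it is close-to-convex relative to the linear map g_1 z.
    - For r itself this domination fails (r'(1) may vanish), but the increments of P and Q are
      dominated: |q_1| bounds the sum of n^2 |q_n| over n >= 2.  Put X_n = rho^n - z^n with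
      |z| = rho < 1.  Then |X_n| <= n |X_1| and 0 <= Re X_n <= n^2 Re X_1, hence both
      Re (P(z) - P(rho)) and Re (Q(z) - Q(rho)) are nonnegative, and so is
      Re ((Q(z) - Q(rho)) conj (P(z) - P(rho))).  From Q(1) >= 0 one gets P(rho) >= Q(rho) > 0.
      Consequently Re Q > 0, which gives univalence, and Re (Q conj P) > 0, which is the classical
      condition Re (z r'/r) > 0 ([starlike_criterion]).
    - That condition yields a starlike image ([radial_solution]): the Euler steps
      z - eta r(z) / r'(z) do not increase |z| and multiply r by 1 - eta up to O(eta^2).  Following
      n of them, with (1 - eta)^n = t, produces approximate solutions of r(z') = t r(z) with
      |z'| <= |z|; since Re r' is bounded below these form a Cauchy family, whose limit is an
      exact solution. *)

(** * Power series with real coefficients in a complex variable *)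

Lemma series_Cmod_le (a : nat -> C) (b : nat -> R) (l : C) (B : R) :
  is_series (a : nat -> C_NormedModule) l -> is_series b B ->
  (forall n, Cmod (a n) <= b n) -> Cmod l <= B.
Proof.
  intros Ha Hb Hab.
  assert (Hn : filterlim (fun n => norm (sum_n (a : nat -> C_NormedModule) n))
                 eventually (locally (norm (l : C_NormedModule)))).
  { apply (filterlim_comp _ _ _ _ norm _ (locally l)); [exact Ha|].
    exact (filterlim_norm (V := C_NormedModule) l). }
  change (Cmod l) with (norm (l : C_NormedModule)).
  apply (is_lim_seq_le (fun n => norm (sum_n (a : nat -> C_NormedModule) n)) (sum_n b)
          (norm (l : C_NormedModule)) B); [|exact Hn|exact Hb].
  intros n. apply Rle_trans with (sum_n (fun k => norm (a k : C_NormedModule)) n).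
  - apply (norm_sum_n_m (a : nat -> C_NormedModule)).
  - apply sum_n_m_le. exact Hab.
Qed.

Lemma Re_sum_n (a : nat -> C) n :
  Re (sum_n (a : nat -> C_NormedModule) n) = sum_n (fun k => Re (a k)) n.
Proof.
  induction n as [|n IH].
  - now rewrite !sum_O.
  - rewrite !sum_Sn, <- IH. reflexivity.
Qed.

Lemma is_series_Re (a : nat -> C) (l : C) :
  is_series (a : nat -> C_NormedModule) l -> is_series (fun n => Re (a n)) (Re l).
Proof.
  intros H. unfold is_series.
  apply filterlim_ext with (fun n => Re (sum_n (a : nat -> C_NormedModule) n)).
  { intros n. apply Re_sum_n. }
  apply (filterlim_comp _ _ _ _ fst _ (locally (l : C_NormedModule))); [exact H|].
  intros P [eps HP]. exists eps. intros y Hy. apply HP. apply Hy.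
Qed.

Lemma is_series_RtoC (a : nat -> R) (l : R) :
  is_series a l -> is_series (fun n => RtoC (a n) : C_NormedModule) (RtoC l).
Proof.
  intros H. unfold is_series.
  apply filterlim_ext with (fun n => RtoC (sum_n a n)).
  { intros n. induction n as [|n IH].
    - now rewrite !sum_O.
    - rewrite !sum_Sn, <- IH. unfold plus; simpl. apply RtoC_plus. }
  apply (filterlim_comp _ _ _ _ RtoC _ (locally l)); [exact H|].
  intros P [eps HP]. exists eps. intros y Hy. apply HP.
  split; [exact Hy|]. apply ball_center.
Qed.

Lemma is_series_C_unique (a : nat -> C) (l l' : C) :
  is_series (a : nat -> C_NormedModule) l ->
  is_series (a : nat -> C_NormedModule) l' -> l = l'.
Proof.
  intros H H'.
  exact (filterlim_locally_unique (V := C_NormedModule) (F := eventually) _ l l' H H').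
Qed.

(** Absolute convergence at every radius: it is inherited by all the sequences derived below from the
    Dini coefficients, and leaves no radius of convergence to keep track of. *)
Definition entire (a : nat -> R) : Prop :=
  forall r, 0 <= r -> ex_series (fun n => Rabs (a n) * r ^ n).

(** The [iota] makes this the same kind of expression as [dini_r], to which it is specialised. *)
Definition cps (a : nat -> R) (z : C) : C :=
  iota (fun l : C_CompleteNormedModule =>
    is_series (fun n : nat => (RtoC (a n) * z ^ n)%C) l).

Lemma iota_series (a : nat -> C) (l : C) :
  is_series (a : nat -> C_NormedModule) l ->
  iota (fun l : C_CompleteNormedModule => is_series a l) = l.
Proof.
  intros H. apply (iota_unique (V := C_CompleteNormedModule)).
  - intros y Hy. exact (is_series_C_unique a y l Hy H).
  - exact H.
Qed.

Lemma cps_correct (a : nat -> R) (z : C) : entire a ->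
  is_series (fun n => (RtoC (a n) * z ^ n)%C : C_NormedModule) (cps a z).
Proof.
  intros Ha.
  destruct (ex_series_le (V := C_CompleteNormedModule)
     (fun n => (RtoC (a n) * z ^ n)%C) (fun n => Rabs (a n) * Cmod z ^ n)) as [l Hl].
  - intros n. change (Cmod (RtoC (a n) * z ^ n) <= Rabs (a n) * Cmod z ^ n).
    rewrite Cmod_mult, Cmod_R, Cmod_pow. apply Rle_refl.
  - apply Ha, Cmod_ge_0.
  - unfold cps. rewrite (iota_series _ l Hl). exact Hl.
Qed.

Lemma entire_CV_radius (a : nat -> R) (x : R) : entire a -> Rbar_lt (Rabs x) (CV_radius a).
Proof.
  intros Ha. apply Rbar_lt_le_trans with (Rabs x + 1); [simpl; lra|].
  pose proof (Rabs_pos x).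
  apply CV_radius_bounded.
  specialize (Ha (Rabs x + 1) ltac:(lra)).
  apply ex_series_lim_0, is_lim_seq_Reals in Ha.
  destruct (maj_by_pos _ (exist _ 0 Ha)) as (M & _ & HM).
  exists M. intros n. specialize (HM n).
  rewrite Rabs_mult, Rabs_Rabsolu in HM. now rewrite Rabs_mult.
Qed.

Lemma entire_is_series (a : nat -> R) (x : R) : entire a ->
  is_series (fun n => a n * x ^ n) (PSeries a x).
Proof.
  intros Ha. apply is_pseries_R, PSeries_correct, CV_radius_inside.
  now apply entire_CV_radius.
Qed.

Lemma cps_RtoC (a : nat -> R) (x : R) : entire a ->
  cps a (RtoC x) = RtoC (PSeries a x).
Proof.
  intros Ha. unfold cps. apply iota_series.
  apply is_series_ext with (fun n => RtoC (a n * x ^ n)).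
  { intros n. now rewrite RtoC_mult, RtoC_pow. }
  apply is_series_RtoC. now apply entire_is_series.
Qed.

Lemma INR_le_pow2 n : INR n <= 2 ^ n.
Proof.
  induction n as [|n IH]; [simpl; lra|].
  rewrite S_INR. simpl. pose proof (pow_R1_Rle 2 n ltac:(lra)). lra.
Qed.

(** Absorbs a factor k^n into the radius; polynomial factors such as n are a special case. *)
Lemma entire_geometric (a b : nat -> R) (k : R) : 0 <= k -> entire a ->
  (forall n, Rabs (b n) <= k ^ n * Rabs (a n)) -> entire b.
Proof.
  intros Hk Ha Hb r Hr.
  apply (ex_series_le (V := R_CompleteNormedModule) _ (fun n => Rabs (a n) * (k * r) ^ n)).
  2: { apply Ha. now apply Rmult_le_pos. }
  intros n. change (Rabs (Rabs (b n) * r ^ n) <= Rabs (a n) * (k * r) ^ n).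
  rewrite Rabs_mult, Rabs_Rabsolu, (Rabs_pos_eq (r ^ n)) by now apply pow_le.
  rewrite Rpow_mult_distr.
  pose proof (pow_le r n Hr). specialize (Hb n). nra.
Qed.

Lemma entire_INR_mult (a : nat -> R) : entire a -> entire (fun n => INR n * a n).
Proof.
  intros Ha. apply (entire_geometric a _ 2); [lra|exact Ha|].
  intros n. rewrite Rabs_mult, Rabs_pos_eq by apply pos_INR.
  apply Rmult_le_compat_r; [apply Rabs_pos|apply INR_le_pow2].
Qed.

Lemma entire_shift (a : nat -> R) : entire a -> entire (fun n => a (S n)).
Proof.
  intros Ha r Hr.
  apply (ex_series_le (V := R_CompleteNormedModule) _
    (fun n => Rabs (a (S n)) * (r + 1) ^ (S n))).
  2: { apply (ex_series_incr_1 (fun n => Rabs (a n) * (r + 1) ^ n)), Ha. lra. }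
  intros n. change (Rabs (Rabs (a (S n)) * r ^ n) <= Rabs (a (S n)) * (r + 1) ^ S n).
  rewrite Rabs_mult, Rabs_Rabsolu.
  rewrite (Rabs_pos_eq (r ^ n)) by now apply pow_le.
  apply Rmult_le_compat_l; [apply Rabs_pos|].
  pose proof (pow_incr r (r + 1) n ltac:(lra)). pose proof (pow_le r n Hr).
  simpl. nra.
Qed.

Lemma entire_PS_derive (a : nat -> R) : entire a -> entire (PS_derive a).
Proof. intros Ha. exact (entire_shift _ (entire_INR_mult a Ha)). Qed.

Lemma entire_PS_incr_1 (a : nat -> R) : entire a -> entire (PS_incr_1 a).
Proof.
  intros Ha r Hr. apply ex_series_incr_1.
  apply ex_series_ext with (fun n => scal r (Rabs (a n) * r ^ n)).
  { intros n. unfold scal; simpl. unfold mult; simpl. ring. }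
  apply (ex_series_scal (V := R_NormedModule)). now apply Ha.
Qed.

Lemma Cpow_diff_le (z w : C) (r : R) n : Cmod z <= r -> Cmod w <= r ->
  Cmod (z ^ n - w ^ n) <= INR n * r ^ pred n * Cmod (z - w).
Proof.
  intros Hz Hw. pose proof (Cmod_ge_0 z). pose proof (Cmod_ge_0 (z - w)).
  induction n as [|n IH].
  - simpl. replace (1 - 1)%C with (RtoC 0) by ring. rewrite Cmod_0. lra.
  - replace (z ^ S n - w ^ S n)%C with (z * (z ^ n - w ^ n) + w ^ n * (z - w))%C
      by (simpl; ring).
    apply Rle_trans with (1 := Cmod_triangle _ _). rewrite !Cmod_mult, Cmod_pow.
    assert (Hp : Cmod w ^ n <= r ^ n) by (apply pow_incr; split; [apply Cmod_ge_0|exact Hw]).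
    rewrite S_INR. cbn [pred].
    assert (Cmod z * Cmod (z ^ n - w ^ n) <= INR n * r ^ n * Cmod (z - w)).
    { apply Rle_trans with (r * (INR n * r ^ pred n * Cmod (z - w))).
      - apply Rmult_le_compat; auto. apply Cmod_ge_0.
      - apply Req_le. destruct n; simpl pred; [simpl; ring|]. simpl pow. ring. }
    nra.
Qed.

(** Requiring 1 <= r lets the same power r^n serve for all n, which is all that convergence of the
    summed bound needs. *)
Lemma Cpow_taylor_le (z w : C) (r : R) n : 1 <= r -> Cmod z <= r -> Cmod w <= r ->
  Cmod (z ^ n - w ^ n - RtoC (INR n) * w ^ pred n * (z - w))
    <= INR n ^ 2 * r ^ n * Cmod (z - w) ^ 2.
Proof.
  intros Hr Hz Hw.
  pose proof (Cmod_ge_0 z). pose proof (Cmod_ge_0 (z - w)).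
  induction n as [|n IH].
  - simpl. replace (1 - 1 - RtoC 0 * 1 * (z - w))%C with (RtoC 0) by ring.
    rewrite Cmod_0. lra.
  - replace (z ^ S n - w ^ S n - RtoC (INR (S n)) * w ^ pred (S n) * (z - w))%C with
      (z * (z ^ n - w ^ n - RtoC (INR n) * w ^ pred n * (z - w))
       + RtoC (INR n) * w ^ pred n * ((z - w) * (z - w)))%C.
    2: { rewrite S_INR, RtoC_plus. destruct n; cbn [pred Cpow]; [simpl INR|]; ring. }
    apply Rle_trans with (1 := Cmod_triangle _ _). rewrite !Cmod_mult, Cmod_pow, Cmod_R.
    rewrite (Rabs_pos_eq (INR n)) by apply pos_INR.
    assert (Hp : Cmod w ^ pred n <= r ^ S n).
    { apply Rle_trans with (r ^ pred n).
      - apply pow_incr; split; [apply Cmod_ge_0|exact Hw].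
      - apply Rle_pow; [exact Hr|lia]. }
    set (d := Cmod (z - w)) in *.
    assert (H1 : Cmod z * Cmod (z ^ n - w ^ n - RtoC (INR n) * w ^ pred n * (z - w))
              <= INR n ^ 2 * r ^ S n * d ^ 2).
    { apply Rle_trans with (r * (INR n ^ 2 * r ^ n * d ^ 2)).
      - apply Rmult_le_compat; auto. apply Cmod_ge_0.
      - apply Req_le. simpl. ring. }
    assert (H2 : INR n * Cmod w ^ pred n * (d * d) <= INR n * r ^ S n * d ^ 2).
    { replace (d ^ 2) with (d * d) by ring.
      apply Rmult_le_compat_r; [nra|]. apply Rmult_le_compat_l; [apply pos_INR|exact Hp]. }
    rewrite (S_INR n).
    assert (H3 : 0 <= INR n * (r ^ S n * d ^ 2)).
    { apply Rmult_le_pos; [apply pos_INR|]. apply Rmult_le_pos; [apply pow_le; lra|].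
      apply pow2_ge_0. }
    assert (H4 : 0 <= (r ^ S n * d ^ 2)).
    { apply Rmult_le_pos; [apply pow_le; lra|].
      apply pow2_ge_0. }
    nra.
Qed.

Lemma cps_PS_derive_series (a : nat -> R) (w : C) : entire a ->
  is_series (fun n => (RtoC (a n) * (RtoC (INR n) * w ^ pred n))%C : C_NormedModule)
    (cps (PS_derive a) w).
Proof.
  intros Ha. apply is_series_decr_1.
  replace (plus _ _) with (cps (PS_derive a) w : C_NormedModule).
  2: { change (cps (PS_derive a) w =
         cps (PS_derive a) w + - (RtoC (a 0%nat) * (RtoC (INR 0) * w ^ 0)))%C.
       simpl. ring. }
  eapply is_series_ext; [|apply (cps_correct (PS_derive a) w), entire_PS_derive, Ha].
  intros n. unfold PS_derive. cbn [pred]. rewrite RtoC_mult.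
  change ((RtoC (INR (S n)) * RtoC (a (S n)) * w ^ n)%C
    = (RtoC (a (S n)) * (RtoC (INR (S n)) * w ^ n))%C). ring.
Qed.

Lemma is_series_C_lin2 (u v w : nat -> C) (lu lv lw k : C) :
  is_series (u : nat -> C_NormedModule) lu ->
  is_series (v : nat -> C_NormedModule) lv ->
  is_series (w : nat -> C_NormedModule) lw ->
  is_series (fun n => (u n - v n - k * w n)%C : C_NormedModule) (lu - lv - k * lw)%C.
Proof.
  intros Hu Hv Hw.
  apply (is_series_minus (V := C_NormedModule) _ _ _ _
    (is_series_minus (V := C_NormedModule) _ _ _ _ Hu Hv)
    (is_series_scal (V := C_NormedModule) k _ _ Hw)).
Qed.

(** The constant is uniform in both points: the same estimate gives complex differentiability, the
    derivative along segments, and the O(eta^2) error of an Euler step. *)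
Lemma cps_taylor (a : nat -> R) (r : R) : entire a -> 1 <= r ->
  exists K, 0 <= K /\ forall z w, Cmod z <= r -> Cmod w <= r ->
    Cmod (cps a z - cps a w - (z - w) * cps (PS_derive a) w) <= K * Cmod (z - w) ^ 2.
Proof.
  intros Ha Hr.
  assert (He : ex_series (fun n => INR n ^ 2 * Rabs (a n) * r ^ n)).
  { pose proof (entire_INR_mult _ (entire_INR_mult _ Ha) r ltac:(lra)) as H.
    eapply ex_series_ext; [|exact H]. intros n. cbv beta.
    rewrite !Rabs_mult, (Rabs_pos_eq (INR n)) by apply pos_INR. simpl. ring. }
  exists (Series (fun n => INR n ^ 2 * Rabs (a n) * r ^ n)). split.
  { apply Rle_trans with (Series (fun n => 0 * 0)).
    - rewrite Series_scal_l. lra.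
    - apply Series_le; [|exact He]. intros n. rewrite Rmult_0_l. split; [lra|].
      apply Rmult_le_pos; [|apply pow_le; lra].
      apply Rmult_le_pos; [apply pow2_ge_0|apply Rabs_pos]. }
  intros z w Hz Hw.
  apply (series_Cmod_le
    (fun n => (RtoC (a n) * z ^ n - RtoC (a n) * w ^ n
       - (z - w) * (RtoC (a n) * (RtoC (INR n) * w ^ pred n)))%C)
    (fun n => INR n ^ 2 * Rabs (a n) * r ^ n * Cmod (z - w) ^ 2)).
  - apply is_series_C_lin2; try apply cps_correct; auto. now apply cps_PS_derive_series.
  - apply is_series_scal_r. now apply Series_correct.
  - intros n.
    replace (RtoC (a n) * z ^ n - RtoC (a n) * w ^ n
       - (z - w) * (RtoC (a n) * (RtoC (INR n) * w ^ pred n)))%C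
     with (RtoC (a n) * (z ^ n - w ^ n - RtoC (INR n) * w ^ pred n * (z - w)))%C by ring.
    rewrite Cmod_mult, Cmod_R.
    pose proof (Cpow_taylor_le z w r n Hr Hz Hw) as H. pose proof (Rabs_pos (a n)). nra.
Qed.

Lemma cps_is_derive (a : nat -> R) (z : C) : entire a ->
  @is_derive C_AbsRing C_NormedModule (cps a) z (cps (PS_derive a) z).
Proof.
  intros Ha. split; [apply is_linear_scal_l|].
  intros x Hx.
  assert (x = z).
  { symmetry. exact (is_filter_lim_locally_unique (V := AbsRing_NormedModule C_AbsRing) _ _ Hx). }
  subst x. intros eps.
  pose proof (Cmod_ge_0 z) as Hz0.
  destruct (cps_taylor a (Cmod z + 1) Ha ltac:(lra)) as (K & HK & HT).
  assert (Hd : 0 < Rmin 1 (eps / (K + 1))).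
  { apply Rmin_pos; [lra|]. apply Rdiv_lt_0_compat; [apply eps|lra]. }
  exists (mkposreal _ Hd). intros y Hy.
  change (Cmod (y - z) < Rmin 1 (eps / (K + 1))) in Hy.
  change (Cmod (cps a y - cps a z - (y - z) * cps (PS_derive a) z) <= eps * Cmod (y - z)).
  pose proof (Rlt_le_trans _ _ _ Hy (Rmin_l _ _)) as Hy1.
  pose proof (Rlt_le_trans _ _ _ Hy (Rmin_r _ _)) as Hy2.
  assert (Hyr : Cmod y <= Cmod z + 1).
  { replace y with (z + (y - z))%C by ring.
    apply Rle_trans with (1 := Cmod_triangle _ _). lra. }
  apply Rle_trans with (1 := HT y z Hyr ltac:(lra)).
  pose proof (Cmod_ge_0 (y - z)).
  apply Rlt_div_r in Hy2; [|lra]. nra.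
Qed.

Lemma C_derive_cps (a : nat -> R) (z : C) : entire a ->
  C_derive (cps a) z = cps (PS_derive a) z.
Proof. intros Ha. apply is_C_derive_unique. now apply cps_is_derive. Qed.

Lemma cps_analytic (a : nat -> R) : entire a -> analytic_on_disk (cps a).
Proof. intros Ha z _. exists (cps (PS_derive a) z). now apply cps_is_derive. Qed.

Lemma is_series_C_tail2 (u : nat -> C) (l : C) :
  is_series (u : nat -> C_NormedModule) l ->
  is_series (fun n => u (S (S n)) : C_NormedModule) (l - u 0%nat - u 1%nat)%C.
Proof.
  intros H.
  apply (is_series_incr_1 (V := C_NormedModule) (fun n => u (S n))).
  apply (is_series_incr_1 (V := C_NormedModule) u).
  match goal with |- is_series _ ?x => replace x with (l : C_NormedModule) end; [exact H|].
  change (l = (l - u 0%nat - u 1%nat) + u 1%nat + u 0%nat)%C. ring.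
Qed.

Lemma cps_PS_incr_1 (p : nat -> R) (z : C) : entire p ->
  cps (PS_incr_1 p) z = (z * cps p z)%C.
Proof.
  intros Hp. apply iota_series. apply is_series_decr_1.
  replace (plus _ _) with ((z * cps p z)%C : C_NormedModule).
  2: { change ((z * cps p z)%C = (z * cps p z + - (RtoC 0 * 1))%C). ring. }
  eapply is_series_ext; [|apply (is_series_scal (V := C_NormedModule) z _ _ (cps_correct p z Hp))].
  intros n. change ((z * (RtoC (p n) * z ^ n))%C = (RtoC (p n) * (z * z ^ n))%C). ring.
Qed.

Lemma C_derive_n_cps (a : nat -> R) (k : nat) : entire a ->
  entire (PS_derive_n k a) /\ C_derive_n (cps a) k = cps (PS_derive_n k a).
Proof.
  intros Ha. induction k as [|k [IH1 IH2]].
  - replace (PS_derive_n 0 a) with a; [split; [exact Ha|reflexivity]|].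
    apply functional_extensionality. intros n. unfold PS_derive_n. rewrite Nat.add_0_r.
    field. apply INR_fact_neq_0.
  - replace (PS_derive_n (S k) a) with (PS_derive (PS_derive_n k a)).
    + split; [now apply entire_PS_derive|]. simpl. rewrite IH2.
      apply functional_extensionality. intros z. now apply C_derive_cps.
    + apply functional_extensionality. intros n. unfold PS_derive, PS_derive_n.
      replace (n + S k)%nat with (S n + k)%nat by lia.
      rewrite (fact_simpl n), mult_INR. field.
      split; [apply INR_fact_neq_0|apply not_0_INR; lia].
Qed.

(** * Weighted sums of the coefficients beyond the linear one *)

(** The index starts at 2: these sums measure what competes with the linear coefficient, with
    j = 1 for distances and j = 2 for real parts. *)
Definition tail_moment (j : nat) (a : nat -> R) : R :=
  Series (fun n => INR (S (S n)) ^ j * Rabs (a (S (S n)))).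

Lemma ex_tail_moment (j : nat) (a : nat -> R) : entire a ->
  ex_series (fun n => INR (S (S n)) ^ j * Rabs (a (S (S n)))).
Proof.
  intros Ha.
  assert (H : entire (fun n => INR n ^ j * a n)).
  { induction j as [|j IH].
    - intros r Hr. eapply ex_series_ext; [|exact (Ha r Hr)].
      intros n. simpl. now rewrite Rmult_1_l.
    - intros r Hr. eapply ex_series_ext; [|exact (entire_INR_mult _ IH r Hr)].
      intros n. simpl. now rewrite Rmult_assoc. }
  pose proof (H 1 ltac:(lra)) as H1.
  apply (ex_series_incr_1 (fun n => INR (S n) ^ j * Rabs (a (S n)))).
  apply (ex_series_incr_1 (fun n => INR n ^ j * Rabs (a n))).
  eapply ex_series_ext; [|exact H1]. intros n. cbv beta.
  rewrite pow1, Rmult_1_r, Rabs_mult, (Rabs_pos_eq (INR n ^ j)); [reflexivity|].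
  apply pow_le, pos_INR.
Qed.

Lemma tail_moment_pos j a : entire a -> 0 <= tail_moment j a.
Proof.
  intros Ha. apply Rle_trans with (Series (fun _ => 0 * 0)).
  - rewrite Series_scal_l. lra.
  - apply Series_le; [|now apply ex_tail_moment]. intros n. rewrite Rmult_0_l.
    split; [lra|]. apply Rmult_le_pos; [apply pow_le, pos_INR|apply Rabs_pos].
Qed.

Lemma is_series_cps_tail (a : nat -> R) (z w : C) : entire a ->
  is_series (fun n => (RtoC (a (S (S n))) * (z ^ S (S n) - w ^ S (S n)))%C : C_NormedModule)
    (cps a z - cps a w - RtoC (a 1%nat) * (z - w))%C.
Proof.
  intros Ha.
  pose proof (is_series_C_tail2 _ _ (is_series_minus (V := C_NormedModule) _ _ _ _
    (cps_correct a z Ha) (cps_correct a w Ha))) as H.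
  match type of H with is_series _ ?x =>
    match goal with |- is_series _ ?y => replace y with x end end.
  - eapply is_series_ext; [|exact H]. intros n.
    change (RtoC (a (S (S n))) * z ^ S (S n) - RtoC (a (S (S n))) * w ^ S (S n)
      = RtoC (a (S (S n))) * (z ^ S (S n) - w ^ S (S n)))%C. ring.
  - change ((cps a z - cps a w - (RtoC (a 0%nat) * 1 - RtoC (a 0%nat) * 1) -
      (RtoC (a 1%nat) * (z * 1) - RtoC (a 1%nat) * (w * 1)))
       = cps a z - cps a w - RtoC (a 1%nat) * (z - w))%C. ring.
Qed.

Lemma cps_linear_part (a : nat -> R) (z w : C) : entire a ->
  Cmod z <= 1 -> Cmod w <= 1 ->
  Cmod (cps a z - cps a w - RtoC (a 1%nat) * (z - w))
    <= tail_moment 1 a * Cmod (z - w).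
Proof.
  intros Ha Hz Hw.
  apply (series_Cmod_le _ _ _ _ (is_series_cps_tail a z w Ha)
    (is_series_scal_r (Cmod (z - w)) _ _ (Series_correct _ (ex_tail_moment 1 a Ha)))).
  intros n. rewrite Cmod_mult, Cmod_R, pow_1.
  pose proof (Cpow_diff_le z w 1 (S (S n)) Hz Hw) as H.
  rewrite pow1, Rmult_1_r in H. pose proof (Rabs_pos (a (S (S n)))). nra.
Qed.

Lemma Cmod_chord_sq (z : C) (r : R) : Cmod z = r ->
  Cmod (RtoC r - z) ^ 2 = 2 * r * (r - Re z).
Proof.
  intros H. assert (H2 : r ^ 2 = Re z ^ 2 + Im z ^ 2) by (rewrite <- H; apply Cmod2_alt).
  rewrite Cmod2_alt. destruct z as [x y]. unfold Re, Im in *. simpl in *. nra.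
Qed.

Lemma Re_chord_pos (z : C) : 0 <= Cmod z - Re z.
Proof. pose proof (re_le_Cmod z). pose proof (Rle_abs (Re z)). lra. Qed.

(** Both sides come from squared chord lengths: |r^n - z^n|^2 = 2 r^n (r^n - Re z^n) when |z| = r,
    and |r^n - z^n| <= n r^(n-1) |r - z|.  This replaces 1 - cos (n t) <= n^2 (1 - cos t) without
    mentioning angles. *)
Lemma Re_chord_pow (z : C) (r : R) n : Cmod z = r -> r <= 1 ->
  r ^ n - Re (z ^ n) <= INR n ^ 2 * (r - Re z).
Proof.
  intros Hz Hr.
  pose proof (Re_chord_pos z) as Hp. rewrite Hz in Hp.
  pose proof (Cmod_ge_0 z) as H0.
  destruct n as [|n]; [simpl; lra|].
  assert (Hp' : 0 <= INR (S n) ^ 2 * (r - Re z)).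
  { apply Rmult_le_pos; [apply pow2_ge_0|exact Hp]. }
  destruct (Req_dec r 0) as [E|E].
  { assert (z = 0) by (apply Cmod_eq_0; lra). subst z. rewrite E in *. cbn [Cpow].
    rewrite Cmult_0_l. simpl pow. simpl Re. rewrite Rmult_0_l. simpl Re in Hp'. simpl in Hp'. simpl. lra. }
  assert (Hrp : 0 < r) by lra.
  assert (Hn : Cmod (z ^ S n) = r ^ S n) by (rewrite Cmod_pow; now rewrite Hz).
  pose proof (Cmod_chord_sq _ _ Hn) as H1.
  pose proof (Cmod_chord_sq _ _ Hz) as H2.
  pose proof (Cpow_diff_le (RtoC r) z r (S n)) as H3.
  rewrite Cmod_R, Rabs_pos_eq in H3 by lra.
  specialize (H3 (Rle_refl _) ltac:(lra)). cbn [pred] in H3.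
  rewrite <- RtoC_pow in H3.
  assert (H4 : Cmod (RtoC (r ^ S n) - z ^ S n) ^ 2
     <= (INR (S n) * r ^ n * Cmod (RtoC r - z)) ^ 2).
  { apply pow_incr. split; [apply Cmod_ge_0|exact H3]. }
  rewrite H1 in H4. rewrite !Rpow_mult_distr, H2 in H4.
  assert (Hrn : 0 < r ^ S n) by now apply pow_lt.
  assert (Hrn' : 0 < r ^ n) by now apply pow_lt.
  assert (r ^ n <= 1) by (rewrite <- (pow1 n); apply pow_incr; lra).
  assert (H5 : r ^ S n - Re (z ^ S n) <= INR (S n) ^ 2 * r ^ n * (r - Re z)).
  { apply Rmult_le_reg_l with (2 * r ^ S n); [lra|].
    apply Rle_trans with (1 := H4). apply Req_le. simpl. ring. }
  apply Rle_trans with (1 := H5). nra.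
Qed.

(** Each term is controlled by n^2 times the same nonnegative quantity r - Re z, so the second moment
    decides the sign of the whole increment. *)
Lemma Re_cps_chord (a : nat -> R) (z : C) (r : R) : entire a ->
  Cmod z = r -> r <= 1 ->
  Rabs (Re (cps a (RtoC r) - cps a z)%C - a 1%nat * (r - Re z))
    <= tail_moment 2 a * (r - Re z).
Proof.
  intros Ha Hz Hr.
  pose proof (is_series_cps_tail a (RtoC r) z Ha) as Hu.
  apply is_series_Re, is_series_RtoC in Hu.
  replace (Rabs _) with (Cmod (RtoC (Re (cps a (RtoC r) - cps a z - RtoC (a 1%nat) * (RtoC r - z))%C))).
  2: { rewrite Cmod_R. f_equal. unfold Cminus at 1. rewrite re_plus, re_opp, re_scal_l.
       unfold Cminus. rewrite !re_plus, !re_opp, re_RtoC. ring. }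
  refine (series_Cmod_le _ (fun n => INR (S (S n)) ^ 2 * Rabs (a (S (S n))) * (r - Re z))
     _ _ Hu _ _).
  - apply is_series_scal_r. apply Series_correct. now apply ex_tail_moment.
  - intros n. rewrite Cmod_R, re_scal_l, Rabs_mult.
    unfold Cminus. rewrite re_plus, re_opp, <- RtoC_pow, re_RtoC.
    pose proof (Re_chord_pow z r (S (S n)) Hz Hr) as H.
    pose proof (Re_chord_pos (z ^ S (S n))) as H'. rewrite Cmod_pow, Hz in H'.
    rewrite (Rabs_pos_eq (_ + - _)) by exact H'. pose proof (Rabs_pos (a (S (S n)))). nra.
Qed.

Lemma tail_moment_compare (j i : nat) (a b : nat -> R) (k : R) : entire a -> entire b ->
  (forall n, (2 <= n)%nat -> INR n ^ j * Rabs (a n) <= k * (INR n ^ i * Rabs (b n))) ->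
  tail_moment j a <= k * tail_moment i b.
Proof.
  intros Ha Hb H. unfold tail_moment. rewrite <- Series_scal_l. apply Series_le.
  - intros n. split; [|apply H; lia].
    apply Rmult_le_pos; [apply pow_le, pos_INR|apply Rabs_pos].
  - apply (ex_series_scal (V := R_NormedModule)), ex_tail_moment, Hb.
Qed.

Lemma INR_ge_2 n : (2 <= n)%nat -> 2 <= INR n.
Proof. intros H. change 2 with (INR 2). now apply le_INR. Qed.

Lemma Series_geometric_le (u : nat -> R) (k A : R) : 0 <= k < 1 ->
  (forall n, 0 <= u n <= A * k ^ n) -> ex_series u /\ Series u <= A / (1 - k).
Proof.
  intros Hk Hu.
  assert (Hs : is_series (fun n => A * k ^ n) (A * / (1 - k))).
  { apply (is_series_scal (V := R_NormedModule) A). apply is_series_geom.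
    rewrite Rabs_pos_eq; lra. }
  split.
  - apply (ex_series_le (V := R_CompleteNormedModule) _ (fun n => A * k ^ n)).
    + intros n. change (Rabs (u n) <= A * k ^ n). rewrite Rabs_pos_eq; apply Hu.
    + now exists (A * / (1 - k)).
  - unfold Rdiv. rewrite <- (is_series_unique _ _ Hs). apply Series_le; [exact Hu|].
    now exists (A * / (1 - k)).
Qed.

Lemma tail_moment_geometric (j : nat) (a : nat -> R) (k A : R) : 0 <= k < 1 ->
  INR 2 ^ j * Rabs (a 2%nat) <= A ->
  (forall n, (2 <= n)%nat -> INR (S n) ^ j * Rabs (a (S n)) <= k * (INR n ^ j * Rabs (a n))) ->
  tail_moment j a <= A / (1 - k).
Proof.
  intros Hk H2 Hn. apply Series_geometric_le; [exact Hk|].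
  intros n. split.
  { apply Rmult_le_pos; [apply pow_le, pos_INR|apply Rabs_pos]. }
  induction n as [|n IH]; [simpl pow in *; lra|].
  apply Rle_trans with (1 := Hn (S (S n)) ltac:(lia)). simpl (k ^ S n).
  assert (k * (INR (S (S n)) ^ j * Rabs (a (S (S n)))) <= k * (A * k ^ n)) by (apply Rmult_le_compat_l; lra).
  lra.
Qed.

(** * Positive real part of the derivative, and radial images *)

Lemma cps_bound (a : nat -> R) : entire a ->
  exists M, 0 < M /\ forall z, Cmod z <= 1 -> Cmod (cps a z) <= M.
Proof.
  intros Ha. destruct (Ha 1 ltac:(lra)) as [S0 HS].
  assert (Hb : forall z, Cmod z <= 1 -> Cmod (cps a z) <= S0).
  { intros z Hz. apply (series_Cmod_le _ _ _ _ (cps_correct a z Ha) HS).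
    intros n. rewrite Cmod_mult, Cmod_R, Cmod_pow.
    apply Rmult_le_compat_l; [apply Rabs_pos|].
    apply pow_incr. split; [apply Cmod_ge_0|exact Hz]. }
  exists (Rabs S0 + 1). split; [pose proof (Rabs_pos S0); lra|].
  intros z Hz. pose proof (Hb z Hz). pose proof (Rle_abs S0). lra.
Qed.

Lemma is_derive_of_quadratic (phi : R -> R) (t l K : R) : 0 <= K ->
  (forall h, Rabs h <= 1 -> Rabs (phi (t + h) - phi t - h * l) <= K * h ^ 2) ->
  is_derive phi t l.
Proof.
  intros HK H. apply is_derive_Reals. intros eps Heps.
  assert (Hd : 0 < Rmin 1 (eps / (K + 1))).
  { apply Rmin_pos; [lra|]. apply Rdiv_lt_0_compat; lra. }
  exists (mkposreal _ Hd). intros h Hh0 Hh. simpl in Hh.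
  pose proof (Rlt_le_trans _ _ _ Hh (Rmin_l _ _)) as Hh1.
  pose proof (Rlt_le_trans _ _ _ Hh (Rmin_r _ _)) as Hh2.
  specialize (H h ltac:(lra)).
  replace ((phi (t + h) - phi t) / h - l) with ((phi (t + h) - phi t - h * l) / h) by (field; auto).
  unfold Rdiv. rewrite Rabs_mult, Rabs_inv.
  pose proof (Rabs_pos_lt h Hh0) as Hp.
  apply Rlt_div_r; [now apply Rinv_0_lt_compat|].
  unfold Rdiv. rewrite Rinv_inv.
  apply Rle_lt_trans with (1 := H). rewrite <- (pow2_abs h).
  apply Rlt_div_r in Hh2; [|lra]. nra.
Qed.

Lemma Cmod_scal_conj (z w : C) : Cmod (Cconj z * w) = Cmod z * Cmod w.
Proof. now rewrite Cmod_mult, Cmod_conj. Qed.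

(** The real mean value theorem along the segment, applied to the component of the function in the
    direction of the segment. *)
Lemma cps_mean_value (a : nat -> R) (z w : C) : entire a ->
  exists s, 0 <= s <= 1 /\
    Re (Cconj (z - w) * (cps a z - cps a w))%C
      = Cmod (z - w) ^ 2 * Re (cps (PS_derive a) (w + RtoC s * (z - w))%C).
Proof.
  intros Ha. set (d := (z - w)%C).
  set (phi := fun t : R => Re (Cconj d * cps a (w + RtoC t * d))%C).
  set (phi' := fun t : R => Cmod d ^ 2 * Re (cps (PS_derive a) (w + RtoC t * d)%C)).
  assert (Hphi : forall t, is_derive phi t (phi' t)).
  { intros t.
    pose proof (Cmod_ge_0 w). pose proof (Cmod_ge_0 d) as Hd. pose proof (Rabs_pos t).
    set (r := Cmod w + (Rabs t + 1) * Cmod d + 1).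
    destruct (cps_taylor a r Ha ltac:(unfold r; nra)) as (K & HK & HT).
    apply is_derive_of_quadratic with (Cmod d * (K * Cmod d ^ 2)).
    { apply Rmult_le_pos; [exact Hd|]. apply Rmult_le_pos; [exact HK|apply pow2_ge_0]. }
    intros h Hh.
    assert (Hr : forall x, Rabs x <= Rabs t + 1 -> Cmod (w + RtoC x * d) <= r).
    { intros x Hx. apply Rle_trans with (1 := Cmod_triangle _ _).
      rewrite Cmod_mult, Cmod_R. unfold r. nra. }
    specialize (HT (w + RtoC (t + h) * d)%C (w + RtoC t * d)%C
      (Hr (t + h) ltac:(pose proof (Rabs_triang t h); lra)) (Hr t ltac:(lra))).
    replace (w + RtoC (t + h) * d - (w + RtoC t * d))%C with (RtoC h * d)%C in HT
      by (rewrite RtoC_plus; ring).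
    rewrite Cmod_mult, Cmod_R, Rpow_mult_distr, pow2_abs in HT.
    match type of HT with Cmod ?e <= _ => set (E := e) in HT end.
    replace (phi (t + h) - phi t - h * phi' t) with (Re (Cconj d * E)%C).
    - apply Rle_trans with (1 := re_le_Cmod _). rewrite Cmod_scal_conj. nra.
    - unfold phi, phi', E. rewrite Cmod2_alt.
      destruct (cps (PS_derive a) (w + RtoC t * d)%C) as [x1 y1].
      destruct (cps a (w + RtoC (t + h) * d)%C) as [x2 y2].
      destruct (cps a (w + RtoC t * d)%C) as [x3 y3].
      destruct d as [x4 y4]. unfold Re, Im. simpl. ring. }
  destruct (MVT_gen phi 0 1 phi') as (s & Hs & Heq).
  - intros x _. apply Hphi.
  - intros x _. apply continuity_pt_filterlim.
    apply (ex_derive_continuous (V := R_NormedModule)). exists (phi' x). apply Hphi.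
  - rewrite Rmin_left, Rmax_right in Hs by lra. exists s. split; [exact Hs|].
    fold phi. change (Cmod d ^ 2 * Re (cps (PS_derive a) (w + RtoC s * d)%C)) with (phi' s).
    replace (phi' s) with (phi 1 - phi 0) by lra. unfold phi.
    replace (w + RtoC 1 * d)%C with z by (unfold d; ring).
    replace (w + RtoC 0 * d)%C with w by (unfold d; ring).
    unfold Cminus, Rminus. rewrite Cmult_plus_distr_l, re_plus.
    f_equal. rewrite <- re_opp. f_equal. ring.
Qed.

Lemma Cmod_segment (z w : C) (s r : R) : Cmod z <= r -> Cmod w <= r -> 0 <= s <= 1 ->
  Cmod (w + RtoC s * (z - w)) <= r.
Proof.
  intros Hz Hw Hs. replace (w + RtoC s * (z - w))%C with (RtoC (1 - s) * w + RtoC s * z)%C.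
  2: { rewrite RtoC_minus. ring. }
  apply Rle_trans with (1 := Cmod_triangle _ _).
  rewrite !Cmod_mult, !Cmod_R, !Rabs_pos_eq by lra. nra.
Qed.

Lemma Cminus_eq0 (z w : C) : Cmod (z - w) = 0 -> z = w.
Proof.
  intros H. apply Cmod_eq_0 in H. replace z with (z - w + w)%C by ring. rewrite H. ring.
Qed.

(** The Noshiro-Warschawski criterion. *)
Lemma Re_derive_pos_univalent (a : nat -> R) : entire a ->
  (forall z, unit_disk z -> 0 < Re (cps (PS_derive a) z)) -> univalent (cps a).
Proof.
  intros Ha H. split; [now apply cps_analytic|].
  intros z w Hz Hw Heq.
  destruct (cps_mean_value a z w Ha) as (s & Hs & E).
  unfold unit_disk in *.
  assert (Hlt : Cmod (w + RtoC s * (z - w)) < 1).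
  { apply Rle_lt_trans with (Rmax (Cmod z) (Cmod w)).
    - apply Cmod_segment; [apply Rmax_l|apply Rmax_r|exact Hs].
    - now apply Rmax_lub_lt. }
  specialize (H _ Hlt). rewrite Heq in E.
  replace (Cconj (z - w) * (cps a w - cps a w))%C with (RtoC 0) in E by ring.
  rewrite re_RtoC in E. symmetry in E.
  apply Rmult_integral in E as [E|E]; [|lra].
  apply Cminus_eq0. pose proof (Cmod_ge_0 (z - w)). nra.
Qed.

Lemma Re_derive_lower_expand (a : nat -> R) (rho m : R) : entire a ->
  (forall z, Cmod z <= rho -> m <= Re (cps (PS_derive a) z)) ->
  forall z w, Cmod z <= rho -> Cmod w <= rho ->
    m * Cmod (z - w) <= Cmod (cps a z - cps a w).
Proof.
  intros Ha H z w Hz Hw.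
  destruct (cps_mean_value a z w Ha) as (s & Hs & E).
  specialize (H _ (Cmod_segment z w s rho Hz Hw Hs)).
  pose proof (Rle_abs (Re (Cconj (z - w) * (cps a z - cps a w))%C)) as H1.
  pose proof (re_le_Cmod (Cconj (z - w) * (cps a z - cps a w))%C) as H2.
  rewrite Cmod_scal_conj in H2. rewrite E in H1, H2.
  pose proof (Cmod_ge_0 (z - w)) as Hd. pose proof (Cmod_ge_0 (cps a z - cps a w)).
  destruct (Req_dec (Cmod (z - w)) 0) as [E0|E0]; [rewrite E0; lra|].
  apply Rmult_le_reg_l with (Cmod (z - w)); [lra|].
  assert (0 <= Cmod (z - w) ^ 2) by apply pow2_ge_0. nra.
Qed.

(** One Euler step for z' = - f/f'.  It moves z by - eta v with v = f/f', and
    |z - eta v|^2 = |z|^2 - 2 eta Re (z conj v) + eta^2 |v|^2, where Re (z conj v) is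
    Re (z f' conj f) / |f'|^2 >= kappa |v|^2; hence the modulus does not grow once eta <= 2 kappa. *)
Lemma radial_step (a : nat -> R) (rho m kappa : R) : entire a ->
  rho <= 1 -> 0 < m -> 0 < kappa ->
  (forall z, Cmod z <= rho -> m <= Re (cps (PS_derive a) z)) ->
  (forall z, Cmod z <= rho ->
     kappa * Cmod (cps a z) ^ 2 <= Re (z * cps (PS_derive a) z * Cconj (cps a z))%C) ->
  exists L, 0 <= L /\ forall eta z, 0 <= eta <= 2 * kappa -> Cmod z <= rho ->
    exists z', Cmod z' <= rho /\
      Cmod (cps a z' - RtoC (1 - eta) * cps a z) <= L * eta ^ 2.
Proof.
  intros Ha Hrho Hm Hk Hd Hs.
  destruct (cps_taylor a 1 Ha (Rle_refl _)) as (K & HK & HT).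
  destruct (cps_bound a Ha) as (B & HB & HBz).
  exists (K * (B / m) ^ 2). split.
  { apply Rmult_le_pos; [exact HK|apply pow2_ge_0]. }
  intros eta z Heta Hz.
  set (f := cps a z). set (g := cps (PS_derive a) z).
  specialize (Hd z Hz). specialize (Hs z Hz). fold f g in Hd, Hs.
  assert (Hg : m <= Cmod g).
  { pose proof (re_le_Cmod g). pose proof (Rle_abs (Re g)). lra. }
  assert (Hg0 : g <> 0).
  { intros E. rewrite E, Cmod_0 in Hg. lra. }
  set (v := (f / g)%C).
  assert (Hfv : f = (v * g)%C) by (unfold v; field; exact Hg0).
  assert (Hv : Cmod v <= B / m).
  { unfold v. rewrite Cmod_div by exact Hg0.
    pose proof (HBz z ltac:(lra)) as Hf. fold f in Hf.
    unfold Rdiv. apply Rmult_le_compat; [apply Cmod_ge_0| |exact Hf|].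
    - apply Rlt_le, Rinv_0_lt_compat. lra.
    - apply Rinv_le_contravar; lra. }
  assert (Hz' : Cmod (z - RtoC eta * v) <= rho).
  { apply Rle_trans with (2 := Hz).
    apply Rsqr_incr_0_var; [|apply Cmod_ge_0]. rewrite !Rsqr_pow2.
    assert (E1 : Re (z * g * Cconj f)%C = Cmod g ^ 2 * Re (z * Cconj v)%C).
    { rewrite Hfv, Cmod2_alt. destruct z, g, v. unfold Re, Im. simpl. ring. }
    assert (E2 : Cmod f ^ 2 = Cmod g ^ 2 * Cmod v ^ 2).
    { rewrite Hfv, Cmod_mult. ring. }
    assert (E3 : Cmod (z - RtoC eta * v) ^ 2
       = Cmod z ^ 2 - 2 * eta * Re (z * Cconj v)%C + eta ^ 2 * Cmod v ^ 2).
    { rewrite !Cmod2_alt. destruct z, v. unfold Re, Im. simpl. ring. }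
    rewrite E1, E2 in Hs.
    assert (Hg2 : 0 < Cmod g ^ 2) by (apply pow_lt; lra).
    assert (H3 : kappa * Cmod v ^ 2 <= Re (z * Cconj v)%C).
    { apply Rmult_le_reg_l with (1 := Hg2). lra. }
    rewrite E3. pose proof (pow2_ge_0 (Cmod v)).
    assert (eta * (eta * Cmod v ^ 2) <= eta * (2 * kappa * Cmod v ^ 2)).
    { apply Rmult_le_compat_l; [lra|]. apply Rmult_le_compat_r; lra. }
    assert (eta * (kappa * Cmod v ^ 2) <= eta * Re (z * Cconj v)%C).
    { apply Rmult_le_compat_l; lra. }
    lra. }
  exists (z - RtoC eta * v)%C. split; [exact Hz'|].
  specialize (HT (z - RtoC eta * v)%C z ltac:(lra) ltac:(lra)).
  fold f g in HT.
  replace (z - RtoC eta * v - z)%C with (RtoC (- eta) * v)%C in HT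
    by (rewrite RtoC_opp; ring).
  replace (cps a (z - RtoC eta * v) - f - RtoC (- eta) * v * g)%C
    with (cps a (z - RtoC eta * v) - RtoC (1 - eta) * f)%C in HT.
  2: { rewrite RtoC_opp, RtoC_minus, <- Cmult_assoc, <- Hfv. ring. }
  apply Rle_trans with (1 := HT).
  rewrite Cmod_mult, Cmod_R, Rabs_Ropp, Rpow_mult_distr, pow2_abs.
  assert (Cmod v ^ 2 <= (B / m) ^ 2) by (apply pow_incr; split; [apply Cmod_ge_0|exact Hv]).
  pose proof (pow2_ge_0 eta).
  rewrite (Rmult_comm (eta ^ 2)), <- Rmult_assoc. apply Rmult_le_compat_r; [assumption|].
  now apply Rmult_le_compat_l.
Qed.

Lemma radial_iterate (a : nat -> R) (rho L eta : R) : 0 <= L -> 0 <= eta <= 1 ->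
  (forall z, Cmod z <= rho -> exists z', Cmod z' <= rho /\
      Cmod (cps a z' - RtoC (1 - eta) * cps a z) <= L * eta ^ 2) ->
  forall n z, Cmod z <= rho -> exists z', Cmod z' <= rho /\
      Cmod (cps a z' - RtoC ((1 - eta) ^ n) * cps a z) <= INR n * (L * eta ^ 2).
Proof.
  intros HL Heta Hstep n z Hz.
  assert (HLe : 0 <= L * eta ^ 2) by (apply Rmult_le_pos; [exact HL|apply pow2_ge_0]).
  induction n as [|n (z1 & Hz1 & H1)].
  - exists z. split; [exact Hz|]. rewrite pow_O.
    replace (cps a z - RtoC 1 * cps a z)%C with (RtoC 0) by ring.
    rewrite Cmod_0. simpl. lra.
  - destruct (Hstep z1 Hz1) as (z2 & Hz2 & H2). exists z2. split; [exact Hz2|].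
    replace (cps a z2 - RtoC ((1 - eta) ^ S n) * cps a z)%C with
      ((cps a z2 - RtoC (1 - eta) * cps a z1)
        + RtoC (1 - eta) * (cps a z1 - RtoC ((1 - eta) ^ n) * cps a z))%C.
    2: { simpl. rewrite RtoC_mult. ring. }
    apply Rle_trans with (1 := Cmod_triangle _ _).
    rewrite Cmod_mult, Cmod_R, Rabs_pos_eq by lra. rewrite S_INR.
    pose proof (Cmod_ge_0 (cps a z1 - RtoC ((1 - eta) ^ n) * cps a z)). nra.
Qed.

(** With n = N steps of size eta = 1 - exp (ln t / N) the product of the factors is exactly t, and the
    accumulated error is N O(1/N^2). *)
Lemma radial_approx (a : nat -> R) (rho m kappa : R) : entire a ->
  rho <= 1 -> 0 < m -> 0 < kappa ->
  (forall z, Cmod z <= rho -> m <= Re (cps (PS_derive a) z)) ->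
  (forall z, Cmod z <= rho ->
     kappa * Cmod (cps a z) ^ 2 <= Re (z * cps (PS_derive a) z * Cconj (cps a z))%C) ->
  forall z t eps, Cmod z <= rho -> 0 < t <= 1 -> 0 < eps ->
    exists z', Cmod z' <= rho /\ Cmod (cps a z' - RtoC t * cps a z) < eps.
Proof.
  intros Ha Hrho Hm Hk Hd Hs z t eps Hz Ht Heps.
  destruct (radial_step a rho m kappa Ha Hrho Hm Hk Hd Hs) as (L & HL & Hstep).
  set (T := - ln t).
  assert (HT : 0 <= T).
  { unfold T. pose proof (ln_le t 1 ltac:(lra) ltac:(lra)). rewrite ln_1 in *. lra. }
  destruct (INR_unbounded (T / (2 * kappa) + L * T ^ 2 / eps + 1)) as (N & HN).
  assert (HA : 0 <= T / (2 * kappa)) by (apply Rdiv_le_0_compat; lra).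
  assert (HBd : 0 <= L * T ^ 2 / eps).
  { apply Rdiv_le_0_compat; [|exact Heps]. apply Rmult_le_pos; [exact HL|apply pow2_ge_0]. }
  assert (HN0 : 0 < INR N) by lra.
  set (eta := 1 - exp (- (T / INR N))).
  assert (Hx : 0 <= T / INR N) by (apply Rdiv_le_0_compat; lra).
  assert (Heta : 0 <= eta <= 1).
  { unfold eta. pose proof (exp_pos (- (T / INR N))).
    assert (exp (- (T / INR N)) <= 1).
    { rewrite <- exp_0. destruct Hx as [Hx|Hx].
      - left. apply exp_increasing. lra.
      - rewrite <- Hx. rewrite Ropp_0. lra. }
    lra. }
  assert (HetaT : eta <= T / INR N).
  { unfold eta. pose proof (exp_ineq1_le (- (T / INR N))). lra. }
  assert (Heta2 : eta <= 2 * kappa).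
  { apply Rle_trans with (1 := HetaT). apply Rle_div_l; [exact HN0|].
    assert (T / (2 * kappa) <= INR N) by lra.
    apply Rle_div_l in H; [|lra]. lra. }
  destruct (radial_iterate a rho L eta HL Heta
    (fun z Hz => Hstep eta z (conj (proj1 Heta) Heta2) Hz) N z Hz) as (z' & Hz' & H).
  exists z'. split; [exact Hz'|].
  assert (Hpow : (1 - eta) ^ N = t).
  { unfold eta. replace (1 - (1 - exp (- (T / INR N)))) with (exp (- (T / INR N))) by ring.
    rewrite <- Rpower_pow by apply exp_pos. unfold Rpower. rewrite ln_exp.
    replace (INR N * - (T / INR N)) with (ln t) by (unfold T; field; lra).
    apply exp_ln. lra. }
  rewrite Hpow in H. apply Rle_lt_trans with (1 := H).
  apply Rle_lt_trans with (INR N * (L * (T / INR N) ^ 2)).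
  - apply Rmult_le_compat_l; [lra|]. apply Rmult_le_compat_l; [exact HL|].
    apply pow_incr. lra.
  - replace (INR N * (L * (T / INR N) ^ 2)) with (L * T ^ 2 / INR N) by (field; lra).
    apply Rlt_div_l; [exact HN0|].
    assert (L * T ^ 2 / eps < INR N) by lra.
    apply Rlt_div_l in H0; [|exact Heps]. lra.
Qed.

(** A lower bound on the expansion of the function makes approximate solutions a Cauchy family.
    They are treated as a filter, which avoids choosing a sequence. *)
Lemma expanding_closed_range (a : nat -> R) (rho m : R) (y : C) : entire a ->
  rho <= 1 -> 0 < m ->
  (forall z w, Cmod z <= rho -> Cmod w <= rho ->
    m * Cmod (z - w) <= Cmod (cps a z - cps a w)) ->
  (forall eps, 0 < eps -> exists z, Cmod z <= rho /\ Cmod (cps a z - y) < eps) ->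
  exists z, Cmod z <= rho /\ cps a z = y.
Proof.
  intros Ha Hrho Hm Hexp Happ.
  set (F := fun P : C_CompleteNormedModule -> Prop =>
     exists eps, 0 < eps /\ forall z, Cmod z <= rho -> Cmod (cps a z - y) < eps -> P z).
  assert (HF : ProperFilter F).
  { split.
    - intros P (eps & He & HP). destruct (Happ eps He) as (z & Hz & H).
      exists z. now apply HP.
    - split.
      + exists 1. split; [lra|auto].
      + intros P Q (e1 & He1 & HP) (e2 & He2 & HQ). exists (Rmin e1 e2).
        split; [now apply Rmin_pos|]. intros z Hz H. split.
        * apply HP; [exact Hz|]. apply Rlt_le_trans with (1 := H), Rmin_l.
        * apply HQ; [exact Hz|]. apply Rlt_le_trans with (1 := H), Rmin_r.
      + intros P Q HPQ (e1 & He1 & HP). exists e1. split; auto. }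
  assert (HC : cauchy F).
  { intros eps. assert (He : 0 < m * eps / 2).
    { apply Rdiv_lt_0_compat; [|lra]. apply Rmult_lt_0_compat; [lra|apply eps]. }
    destruct (Happ _ He) as (x & Hx & Hxe). exists x.
    exists (m * eps / 2). split; [exact He|]. intros z Hz Hze.
    apply (C_NormedModule_mixin_compat1 x z eps).
    change (Cmod (z - x) < eps).
    apply Rmult_lt_reg_l with m; [exact Hm|].
    apply Rle_lt_trans with (1 := Hexp z x Hz Hx).
    replace (cps a z - cps a x)%C with ((cps a z - y) + - (cps a x - y))%C by ring.
    apply Rle_lt_trans with (1 := Cmod_triangle _ _). rewrite Cmod_opp. lra. }
  set (zs := lim F : C).
  assert (Hlim : forall d, 0 < d -> exists z, Cmod z <= rho /\ Cmod (cps a z - y) < d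
             /\ Cmod (z - zs) < d).
  { intros d Hd.
    assert (Hs2 : 0 < sqrt 2) by (apply sqrt_lt_R0; lra).
    assert (Hd' : 0 < d / sqrt 2) by (apply Rdiv_lt_0_compat; lra).
    destruct (complete_cauchy F HF HC (mkposreal _ Hd')) as (e & He & HP).
    destruct (Happ (Rmin e d) (Rmin_pos _ _ He Hd)) as (z & Hz & Hze).
    exists z. split; [exact Hz|]. split.
    - apply Rlt_le_trans with (1 := Hze), Rmin_r.
    - specialize (HP z Hz (Rlt_le_trans _ _ _ Hze (Rmin_l _ _))).
      pose proof (C_NormedModule_mixin_compat2 zs z _ HP) as H2.
      change (Cmod (z - zs) < sqrt 2 * (d / sqrt 2)) in H2.
      replace (sqrt 2 * (d / sqrt 2)) with d in H2 by (field; lra). exact H2. }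
  exists zs.
  assert (Hzs : Cmod zs <= rho).
  { apply Rnot_lt_le. intros Hc.
    destruct (Hlim (Cmod zs - rho) ltac:(lra)) as (z & Hz & _ & H).
    assert (Cmod zs <= Cmod z + Cmod (z - zs)).
    { replace zs with (z + - (z - zs))%C at 1 by ring.
      apply Rle_trans with (1 := Cmod_triangle _ _). rewrite Cmod_opp. lra. }
    lra. }
  split; [exact Hzs|]. apply Cminus_eq0.
  destruct (cps_taylor a 1 Ha (Rle_refl _)) as (K & HK & HT).
  set (g := Cmod (cps (PS_derive a) zs)).
  assert (Hg : 0 <= g) by apply Cmod_ge_0.
  pose proof (Cmod_ge_0 (cps a zs - y)) as H0.
  destruct (Rle_lt_or_eq_dec _ _ H0) as [Hpos|E]; [exfalso|auto].
  set (e := Cmod (cps a zs - y)) in *.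
  assert (Hd : 0 < Rmin 1 (e / (K + g + 1))).
  { apply Rmin_pos; [lra|]. apply Rdiv_lt_0_compat; lra. }
  destruct (Hlim _ Hd) as (z & Hz & H1 & H2).
  set (d := Rmin 1 (e / (K + g + 1))) in *.
  assert (Hd1 : d <= 1) by apply Rmin_l.
  assert (Hd2 : d <= e / (K + g + 1)) by apply Rmin_r.
  apply Rle_div_r in Hd2; [|lra].
  specialize (HT z zs ltac:(lra) ltac:(lra)).
  assert (H3 : e <= Cmod (cps a z - y)
     + (Cmod (cps a z - cps a zs - (z - zs) * cps (PS_derive a) zs) + Cmod (z - zs) * g)).
  { unfold e, g. rewrite <- Cmod_mult.
    replace (cps a zs - y)%C with ((cps a z - y) + - ((cps a z - cps a zs
      - (z - zs) * cps (PS_derive a) zs) + (z - zs) * cps (PS_derive a) zs))%C by ring.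
    apply Rle_trans with (1 := Cmod_triangle _ _). rewrite Cmod_opp.
    apply Rplus_le_compat_l, Cmod_triangle. }
  pose proof (Cmod_ge_0 (z - zs)).
  assert (Cmod (z - zs) ^ 2 <= d * 1) by nra.
  nra.
Qed.

Lemma radial_solution (a : nat -> R) (rho m kappa : R) : entire a ->
  0 <= rho <= 1 -> 0 < m -> 0 < kappa ->
  (forall z, Cmod z <= rho -> m <= Re (cps (PS_derive a) z)) ->
  (forall z, Cmod z <= rho ->
     kappa * Cmod (cps a z) ^ 2 <= Re (z * cps (PS_derive a) z * Cconj (cps a z))%C) ->
  forall z t, Cmod z <= rho -> 0 <= t <= 1 ->
    exists z', Cmod z' <= rho /\ cps a z' = (RtoC t * cps a z)%C.
Proof.
  intros Ha Hrho Hm Hk Hd Hs z t Hz [[Ht|Ht] Ht1].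
  - apply (expanding_closed_range a rho m); try lra; auto.
    + now apply Re_derive_lower_expand.
    + intros eps He. apply (radial_approx a rho m kappa); auto; lra.
  - exists (RtoC 0). rewrite Cmod_0. split; [lra|]. subst t. rewrite Cmult_0_l.
    specialize (Hs (RtoC 0)). rewrite Cmod_0, !Cmult_0_l, re_RtoC in Hs.
    specialize (Hs ltac:(lra)). apply Cmod_eq_0.
    pose proof (Cmod_ge_0 (cps a (RtoC 0))).
    destruct H as [H|H]; [|auto]. assert (0 < Cmod (cps a (RtoC 0)) ^ 2) by (now apply pow_lt).
    nra.
Qed.

(** * Close-to-convexity and starlikeness from the coefficients *)

Lemma dominant_linear_univalent (a : nat -> R) : entire a ->
  tail_moment 1 a < Rabs (a 1%nat) -> univalent (cps a).
Proof.
  intros Ha Hdom. split; [now apply cps_analytic|].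
  intros z w Hz Hw Heq. unfold unit_disk in *.
  pose proof (cps_linear_part a z w Ha ltac:(lra) ltac:(lra)) as H.
  rewrite Heq in H.
  replace (cps a w - cps a w - RtoC (a 1%nat) * (z - w))%C
    with (- (RtoC (a 1%nat) * (z - w)))%C in H by ring.
  rewrite Cmod_opp, Cmod_mult, Cmod_R in H.
  apply Cminus_eq0. pose proof (Cmod_ge_0 (z - w)). nra.
Qed.

Lemma cps_PS_derive_near (a : nat -> R) (z : C) : entire a -> Cmod z <= 1 ->
  Cmod (cps (PS_derive a) z - RtoC (a 1%nat)) <= tail_moment 1 a.
Proof.
  intros Ha Hz.
  pose proof (is_series_C_tail2 _ _ (cps_PS_derive_series a z Ha)) as H.
  replace (cps (PS_derive a) z - RtoC (a 1%nat))%C with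
    (cps (PS_derive a) z - RtoC (a 0%nat) * (RtoC (INR 0) * z ^ pred 0)
      - RtoC (a 1%nat) * (RtoC (INR 1) * z ^ pred 1))%C by (simpl; ring).
  apply (series_Cmod_le _ _ _ _ H (Series_correct _ (ex_tail_moment 1 a Ha))).
  intros n. rewrite !Cmod_mult, !Cmod_R, Cmod_pow.
  rewrite (Rabs_pos_eq (INR _)) by apply pos_INR.
  assert (Cmod z ^ pred (S (S n)) <= 1).
  { rewrite <- (pow1 (pred (S (S n)))). apply pow_incr. split; [apply Cmod_ge_0|exact Hz]. }
  rewrite pow_1, Rmult_comm. apply Rmult_le_compat_r; [apply Rabs_pos|].
  pose proof (pos_INR (S (S n))). nra.
Qed.

(** The comparison function is the linear part itself: f'/f'(0) stays within distance 1 of 1. *)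
Lemma dominant_linear_close_to_convex (a : nat -> R) : entire a ->
  tail_moment 1 a < Rabs (a 1%nat) -> close_to_convex (cps a).
Proof.
  intros Ha Hdom. set (c := a 1%nat) in *.
  assert (Hc : c <> 0).
  { intros E. rewrite E, Rabs_R0 in Hdom. pose proof (tail_moment_pos 1 a Ha). lra. }
  assert (HcC : RtoC c <> 0) by (intros E; apply Hc; now apply RtoC_inj).
  split; [now apply cps_analytic|].
  exists (fun z => (RtoC c * z)%C).
  assert (Hder : forall z, @is_derive C_AbsRing C_NormedModule (fun z => (RtoC c * z)%C) z (RtoC c)).
  { intros z.
    split; [apply is_linear_scal_l|].
    intros x Hx.
    assert (x = z).
    { symmetry. exact (is_filter_lim_locally_unique (V := AbsRing_NormedModule C_AbsRing) _ _ Hx). }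
    subst x. intros eps. exists (mkposreal 1 Rlt_0_1). intros y _.
    change (Cmod (RtoC c * y - RtoC c * z - (y - z) * RtoC c) <= eps * Cmod (y - z)).
    replace (RtoC c * y - RtoC c * z - (y - z) * RtoC c)%C with (RtoC 0) by ring.
    rewrite Cmod_0. apply Rmult_le_pos; [apply Rlt_le, eps|apply Cmod_ge_0]. }
  split; [split; [split|]|].
  - intros z _. exists (RtoC c). apply Hder.
  - intros z w _ _ H. apply (f_equal (fun u => (/ RtoC c * u)%C)) in H.
    rewrite !Cmult_assoc, Cinv_l, !Cmult_1_l in H by exact HcC. exact H.
  - intros w1 w2 t (z1 & Hz1 & E1) (z2 & Hz2 & E2) Ht.
    exists (RtoC (1 - t) * z1 + RtoC t * z2)%C. split; [|rewrite <- E1, <- E2; ring].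
    unfold unit_disk in *. apply Rle_lt_trans with (1 := Cmod_triangle _ _).
    rewrite !Cmod_mult, !Cmod_R, !Rabs_pos_eq by lra.
    pose proof (Rmax_l (Cmod z1) (Cmod z2)). pose proof (Rmax_r (Cmod z1) (Cmod z2)).
    pose proof (Rmax_lub_lt (Cmod z1) (Cmod z2) 1 Hz1 Hz2). nra.
  - intros z Hz. unfold unit_disk in Hz.
    rewrite C_derive_cps by exact Ha.
    replace (C_derive (fun z0 => (RtoC c * z0)%C) z) with (RtoC c)
      by (symmetry; apply is_C_derive_unique, Hder).
    pose proof (cps_PS_derive_near a z Ha ltac:(lra)) as H. fold c in H.
    set (g := cps (PS_derive a) z) in *.
    replace (g / RtoC c)%C with (RtoC 1 + (g - RtoC c) / RtoC c)%C by (field; exact HcC).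
    rewrite re_plus, re_RtoC.
    pose proof (re_le_Cmod ((g - RtoC c) / RtoC c)%C) as H1.
    rewrite Cmod_div, Cmod_R in H1 by exact HcC.
    assert (H2 : Cmod (g - RtoC c) / Rabs c < 1).
    { apply Rlt_div_l; [now apply Rabs_pos_lt|]. lra. }
    pose proof (Rle_abs (- Re ((g - RtoC c) / RtoC c)%C)) as H3. rewrite Rabs_Ropp in H3.
    lra.
Qed.

Section starlike_criterion.

Variable p : nat -> R.
Hypothesis Hp : entire p.

(** The coefficients of the derivative of z P(z), where P is the sum of p. *)
Let q := PS_derive (PS_incr_1 p).

Lemma q_coef n : q n = INR (S n) * p n.
Proof. reflexivity. Qed.

Lemma entire_q : entire q.
Proof. now apply entire_PS_derive, entire_PS_incr_1. Qed.

Hypothesis Hp1 : p 1%nat < 0.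
Hypothesis Hdom : tail_moment 2 q <= - q 1%nat.

Let c := - q 1%nat.

Lemma p1_c : p 1%nat = - c / 2.
Proof. unfold c. rewrite q_coef. simpl. field. Qed.

Lemma c_pos : 0 < c.
Proof. pose proof p1_c. lra. Qed.

Lemma first_moment_q : tail_moment 1 q <= c / 2.
Proof.
  apply Rle_trans with (/ 2 * tail_moment 2 q); [|unfold c; lra].
  apply tail_moment_compare; try apply entire_q.
  intros n Hn. pose proof (INR_ge_2 n Hn). pose proof (Rabs_pos (q n)).
  assert (0 <= INR n * Rabs (q n)) by (apply Rmult_le_pos; lra). nra.
Qed.

Lemma second_moment_p : tail_moment 2 p <= c / 3.
Proof.
  apply Rle_trans with (/ 3 * tail_moment 2 q); [|unfold c; lra].
  apply tail_moment_compare; [exact Hp|apply entire_q|].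
  intros n Hn. pose proof (INR_ge_2 n Hn). pose proof (Rabs_pos (p n)).
  rewrite q_coef, Rabs_mult, (Rabs_pos_eq (INR (S n))), S_INR by apply pos_INR.
  assert (0 <= INR n ^ 2 * Rabs (p n)) by (apply Rmult_le_pos; [apply pow2_ge_0|lra]). nra.
Qed.

Lemma first_moment_p : tail_moment 1 p <= c / 6.
Proof.
  apply Rle_trans with (/ 2 * tail_moment 2 p); [|pose proof second_moment_p; lra].
  apply tail_moment_compare; try exact Hp.
  intros n Hn. pose proof (INR_ge_2 n Hn). pose proof (Rabs_pos (p n)).
  assert (0 <= INR n * Rabs (p n)) by (apply Rmult_le_pos; lra). nra.
Qed.

(** In particular Q(r) > 0 for r < 1 as soon as Q(1) >= 0: on [0, 1] the function Q decreases
    at least half as fast as its linear part. *)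
Lemma q_radial (r : R) : 0 <= r <= 1 ->
  PSeries q 1 + c / 2 * (1 - r) <= PSeries q r.
Proof.
  intros Hr.
  pose proof (cps_linear_part q (RtoC r) (RtoC 1) entire_q) as H.
  rewrite !Cmod_R, !Rabs_pos_eq in H by lra. specialize (H ltac:(lra) ltac:(lra)).
  rewrite !cps_RtoC in H by apply entire_q.
  rewrite <- !RtoC_minus, <- RtoC_mult, <- RtoC_minus, !Cmod_R in H.
  replace (Rabs (r - 1)) with (1 - r) in H by (rewrite Rabs_minus_sym, Rabs_pos_eq; lra).
  pose proof first_moment_q as Hm.
  pose proof (Rle_abs (-(PSeries q r - PSeries q 1 - q 1%nat * (r - 1)))) as H1.
  rewrite Rabs_Ropp in H1.
  replace (q 1%nat) with (- c) in * by (unfold c; ring). nra.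
Qed.

(** The difference Q - P has coefficients n p_n, whose linear term p_1 r is negative and dominates. *)
Lemma p_ge_q (r : R) : 0 <= r <= 1 -> PSeries q r <= PSeries p r.
Proof.
  intros Hr. set (d := fun n => INR n * p n).
  assert (Hd : entire d) by now apply entire_INR_mult.
  pose proof (cps_linear_part d (RtoC r) (RtoC 0) Hd) as H.
  rewrite !Cmod_R, !Rabs_pos_eq in H by lra. specialize (H ltac:(lra) ltac:(lra)).
  rewrite !cps_RtoC in H by apply Hd.
  rewrite <- !RtoC_minus, <- RtoC_mult, <- RtoC_minus, !Cmod_R in H.
  rewrite Rminus_0_r, (Rabs_pos_eq r) in H by lra.
  rewrite PSeries_0 in H. unfold d at 2 3 in H. simpl (INR 0) in H. simpl (INR 1) in H.
  assert (Hm : tail_moment 1 d <= c / 3).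
  { apply Rle_trans with (1 * tail_moment 2 p); [|pose proof second_moment_p; lra].
    apply tail_moment_compare; [exact Hd|exact Hp|].
    intros n _. unfold d. rewrite Rabs_mult, Rabs_pos_eq by apply pos_INR. simpl. lra. }
  assert (Hs : PSeries q r = PSeries d r + PSeries p r).
  { assert (Hex : forall a, entire a -> ex_series (fun n => a n * r ^ n)).
    { intros a Ha. exists (PSeries a r). now apply entire_is_series. }
    unfold PSeries. rewrite <- Series_plus by now apply Hex.
    apply Series_ext. intros n. rewrite q_coef, S_INR. unfold d. ring. }
  rewrite p1_c in H.
  pose proof (Rle_abs (PSeries d r - 0 * p 0%nat - 1 * (- c / 2) * r)).
  pose proof c_pos. nra.
Qed.

Lemma Re_q_ge (z : C) (r : R) : Cmod z = r -> r <= 1 ->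
  0 <= Re (cps q z - RtoC (PSeries q r))%C.
Proof.
  intros Hz Hr. pose proof (Re_cps_chord q z r entire_q Hz Hr) as H.
  rewrite cps_RtoC in H by apply entire_q.
  pose proof (Re_chord_pos z). rewrite Hz in *.
  unfold Cminus in *. rewrite re_plus, re_opp, re_RtoC in *.
  pose proof (Rle_abs (PSeries q r + - Re (cps q z) - q 1%nat * (r - Re z))).
  nra.
Qed.

Lemma Re_p_ge (z : C) (r : R) : Cmod z = r -> r <= 1 ->
  0 <= Re (cps p z - RtoC (PSeries p r))%C.
Proof.
  intros Hz Hr. pose proof (Re_cps_chord p z r Hp Hz Hr) as H.
  rewrite cps_RtoC in H by apply Hp.
  pose proof (Re_chord_pos z). rewrite Hz in *.
  unfold Cminus in *. rewrite re_plus, re_opp, re_RtoC in *.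
  pose proof (Rle_abs (PSeries p r + - Re (cps p z) - p 1%nat * (r - Re z))).
  pose proof second_moment_p. pose proof c_pos. rewrite p1_c in *.
  nra.
Qed.

(** With X = z - r, the increments are - c (X + E) and - (c / 2) (X + F) where |E| <= |X| / 2 and
    |F| <= |X| / 3, and 1 - 1/2 - 1/3 - 1/6 = 0. *)
Lemma Re_increments_ge (z : C) (r : R) : Cmod z = r -> r <= 1 ->
  0 <= Re ((cps q z - RtoC (PSeries q r)) * Cconj (cps p z - RtoC (PSeries p r)))%C.
Proof.
  intros Hz Hr.
  assert (Hr0 : 0 <= r) by (rewrite <- Hz; apply Cmod_ge_0).
  assert (Hrr : Cmod (RtoC r) <= 1) by (rewrite Cmod_R, Rabs_pos_eq; lra).
  pose proof (cps_linear_part q z (RtoC r) entire_q ltac:(lra) Hrr) as Hq.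
  pose proof (cps_linear_part p z (RtoC r) Hp ltac:(lra) Hrr) as Hpp.
  rewrite cps_RtoC in Hq by apply entire_q. rewrite cps_RtoC in Hpp by apply Hp.
  set (dq := (cps q z - RtoC (PSeries q r))%C) in *.
  set (dp := (cps p z - RtoC (PSeries p r))%C) in *.
  set (X := (z - RtoC r)%C) in *.
  pose proof c_pos as Hc. pose proof first_moment_q. pose proof first_moment_p.
  replace (q 1%nat) with (- c) in Hq by (unfold c; ring). rewrite p1_c in Hpp.
  set (Eq := (dq - RtoC (- c) * X)%C) in *.
  set (Ep := (dp - RtoC (- c / 2) * X)%C) in *.
  assert (Hx : 0 <= Cmod X) by apply Cmod_ge_0.
  assert (HEq : Cmod Eq <= c / 2 * Cmod X) by nra.
  assert (HEp : Cmod Ep <= c / 6 * Cmod X) by nra.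
  replace (Re (dq * Cconj dp)%C) with
    (c * (c / 2) * Cmod X ^ 2 + Re (- (RtoC c * (X * Cconj Ep)))%C
      + Re (- (RtoC (c / 2) * (Eq * Cconj X)))%C + Re (Eq * Cconj Ep)%C).
  2: { assert (Eq1 : dq = (Eq + RtoC (- c) * X)%C) by (unfold Eq; ring).
       assert (Ep1 : dp = (Ep + RtoC (- c / 2) * X)%C) by (unfold Ep; ring).
       rewrite Eq1, Ep1, Cmod2_alt. generalize Eq, Ep, X, c.
       intros [x1 y1] [x2 y2] [x3 y3] k. unfold Re, Im. simpl. field. }
  assert (HRe : forall u : C, - Cmod u <= Re u).
  { intros u. pose proof (re_le_Cmod u). pose proof (Rle_abs (- Re u)).
    rewrite Rabs_Ropp in *. lra. }
  pose proof (HRe (- (RtoC c * (X * Cconj Ep)))%C) as H1.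
  pose proof (HRe (- (RtoC (c / 2) * (Eq * Cconj X)))%C) as H2.
  pose proof (HRe (Eq * Cconj Ep)%C) as H3.
  rewrite Cmod_opp in H1, H2.
  rewrite !Cmod_mult, ?Cmod_conj, Cmod_R, Rabs_pos_eq in H1 by lra.
  rewrite !Cmod_mult, ?Cmod_conj, Cmod_R, Rabs_pos_eq in H2 by lra.
  rewrite Cmod_mult, Cmod_conj in H3.
  pose proof (Cmod_ge_0 Eq). pose proof (Cmod_ge_0 Ep).
  assert (Cmod X * Cmod Ep <= Cmod X * (c / 6 * Cmod X)) by (now apply Rmult_le_compat_l).
  assert (Cmod Eq * Cmod X <= c / 2 * Cmod X * Cmod X) by (now apply Rmult_le_compat_r).
  assert (Cmod Eq * Cmod Ep <= (c / 2 * Cmod X) * (c / 6 * Cmod X)) by (now apply Rmult_le_compat).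
  assert (c * (Cmod X * Cmod Ep) <= c * (Cmod X * (c / 6 * Cmod X))) by (apply Rmult_le_compat_l; lra).
  assert (c / 2 * (Cmod Eq * Cmod X) <= c / 2 * (c / 2 * Cmod X * Cmod X))
    by (apply Rmult_le_compat_l; lra).
  lra.
Qed.

(** Expanding Q conj P around the positive numbers Q(r) and P(r) leaves only terms with nonnegative
    real part besides Q(r) P(r). *)
Lemma Re_q_conj_p_ge (z : C) (r : R) : Cmod z = r -> r <= 1 -> 0 <= PSeries q r ->
  PSeries q r ^ 2 <= Re (cps q z * Cconj (cps p z))%C.
Proof.
  intros Hz Hr Hpos.
  assert (Hr0 : 0 <= r) by (rewrite <- Hz; apply Cmod_ge_0).
  pose proof (p_ge_q r ltac:(lra)) as H0.
  pose proof (Re_q_ge z r Hz Hr) as H1. pose proof (Re_p_ge z r Hz Hr) as H2.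
  pose proof (Re_increments_ge z r Hz Hr) as H3.
  replace (Re (cps q z * Cconj (cps p z))%C) with
    (PSeries q r * PSeries p r + PSeries p r * Re (cps q z - RtoC (PSeries q r))%C
     + PSeries q r * Re (cps p z - RtoC (PSeries p r))%C
     + Re ((cps q z - RtoC (PSeries q r)) * Cconj (cps p z - RtoC (PSeries p r)))%C).
  2: { destruct (cps q z), (cps p z). unfold Re, Im. simpl. ring. }
  nra.
Qed.

(** A lower bound for Q on [0, |z|] gives one for Re Q and for Re (Q conj P) on the whole disc of that
    radius, and these two are the hypotheses of [radial_solution]. *)
Lemma starlike_criterion : 0 <= PSeries q 1 -> starlike (cps (PS_incr_1 p)).
Proof.
  intros H1. set (f := PS_incr_1 p).
  assert (Hf : entire f) by now apply entire_PS_incr_1.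
  pose proof c_pos as Hc.
  assert (Hreal : forall z, Cmod z <= 1 -> c / 2 * (1 - Cmod z) <= PSeries q (Cmod z)).
  { intros z Hz. pose proof (q_radial (Cmod z) (conj (Cmod_ge_0 z) Hz)). lra. }
  assert (Hre : forall z, Cmod z <= 1 -> c / 2 * (1 - Cmod z) <= Re (cps q z)).
  { intros z Hz. pose proof (Hreal z Hz). pose proof (Re_q_ge z _ eq_refl Hz) as H2.
    unfold Cminus in H2. rewrite re_plus, re_opp, re_RtoC in H2. lra. }
  split.
  - apply Re_derive_pos_univalent; [exact Hf|].
    intros z Hz. unfold unit_disk in Hz. change (PS_derive f) with q.
    pose proof (Hre z ltac:(lra)). nra.
  - intros w t (z & Hz & E) Ht. unfold unit_disk in Hz.
    destruct (cps_bound p Hp) as (M & HM & HMb).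
    set (rho := Cmod z) in *. pose proof (Cmod_ge_0 z) as Hz0. fold rho in Hz0.
    set (m := c / 2 * (1 - rho)).
    assert (Hm : 0 < m) by (unfold m; nra).
    assert (Hmono : forall x, Cmod x <= rho -> m <= c / 2 * (1 - Cmod x)).
    { intros x Hx. unfold m. nra. }
    (* Re (x Q conj (x P)) = |x|^2 Re (Q conj P) >= |x|^2 m^2, and |x P| <= M |x|: this is where
       the constant (m / M)^2 comes from. *)
    destruct (radial_solution f rho m ((m / M) ^ 2) Hf) with (z := z) (t := t)
      as (z' & Hz' & E'); try lra.
    + apply pow_lt. apply Rdiv_lt_0_compat; lra.
    + intros x Hx. change (PS_derive f) with q.
      pose proof (Hre x ltac:(lra)). pose proof (Hmono x Hx). lra.
    + intros x Hx. change (PS_derive f) with q. unfold f. rewrite cps_PS_incr_1 by exact Hp.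
      pose proof (Hreal x ltac:(lra)) as H3. pose proof (Hmono x Hx) as H4.
      pose proof (Re_q_conj_p_ge x _ eq_refl ltac:(lra) ltac:(lra)) as H5.
      replace (Re (x * cps q x * Cconj (x * cps p x))%C)
        with (Cmod x ^ 2 * Re (cps q x * Cconj (cps p x))%C).
      2: { rewrite Cmod2_alt. destruct x, (cps q _), (cps p _). unfold Re, Im. simpl. ring. }
      rewrite Cmod_mult, Rpow_mult_distr.
      assert (H6 : (m / M) ^ 2 * Cmod (cps p x) ^ 2 <= m ^ 2).
      { rewrite <- Rpow_mult_distr. apply pow_incr. pose proof (HMb x ltac:(lra)).
        pose proof (Cmod_ge_0 (cps p x)).
        assert (0 < m / M) by (apply Rdiv_lt_0_compat; lra). split; [nra|].
        replace m with (m / M * M) at 2 by (field; lra). nra. }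
      assert (H7 : m ^ 2 <= PSeries q (Cmod x) ^ 2) by (apply pow_incr; lra).
      pose proof (pow2_ge_0 (Cmod x)). nra.
    + unfold rho. lra.
    + exists z'. split; [unfold unit_disk; lra|]. rewrite E', E. reflexivity.
Qed.

End starlike_criterion.

(** * Univalence and the sign of the derivative at 1 *)

Lemma peak_not_injective (phi : R -> R) (x y z : R) : x < y < z ->
  continuity phi -> phi x < phi y -> phi z < phi y ->
  exists s t, x <= s /\ s < t /\ t < z /\ phi s = phi t.
Proof.
  intros Hxyz Hc Hx Hz.
  set (v := Rmax (phi x) (phi z)).
  assert (Hv : v < phi y) by (now apply Rmax_lub_lt).
  pose proof (Rmax_l (phi x) (phi z)) as H1. pose proof (Rmax_r (phi x) (phi z)) as H2.
  fold v in H1, H2. set (u := (v + phi y) / 2).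
  destruct (IVT_gen phi x y u Hc) as (s & Hs & Es).
  { rewrite Rmin_left, Rmax_right; unfold u; lra. }
  destruct (IVT_gen phi y z u Hc) as (t & Ht & Et).
  { rewrite Rmin_right, Rmax_left; unfold u; lra. }
  rewrite Rmin_left, Rmax_right in Hs, Ht by lra.
  assert (s <> y) by (intros ->; unfold u in Es; lra).
  assert (t <> z) by (intros ->; unfold u in Et; lra).
  exists s, t. repeat split; lra.
Qed.

Lemma derive_sign (phi : R -> R) (t l : R) : is_derive phi t l -> l <> 0 ->
  exists d, 0 < d /\ forall h, 0 < Rabs h < d -> 0 < l * h * (phi (t + h) - phi t).
Proof.
  intros H Hl. apply is_derive_Reals in H.
  destruct (H (Rabs l) (Rabs_pos_lt l Hl)) as (d & Hd).
  exists d. split; [apply d|]. intros h Hh.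
  assert (h <> 0) by (intros ->; rewrite Rabs_R0 in Hh; lra).
  specialize (Hd h H0 (proj2 Hh)).
  replace (l * h * (phi (t + h) - phi t)) with (h ^ 2 * (l * ((phi (t + h) - phi t) / h)))
    by (field; auto).
  set (k := (phi (t + h) - phi t) / h) in *.
  assert (0 < h ^ 2) by (apply pow2_gt_0; exact H0).
  apply Rmult_lt_0_compat; [exact H1|].
  unfold Rabs in Hd. destruct (Rcase_abs (k - l)), (Rcase_abs l); nra.
Qed.

(** Going to the right from 0 the function rises, and it is falling when it reaches 1, so some
    value is taken twice in [0, 1): either the value just left of 1 exceeds the one at 0, and it is
    a peak between 0 and 1, or the values just right of 0 are a peak. *)
Lemma univalent_derivative_at_1 (a : nat -> R) : entire a -> univalent (cps a) ->
  0 < a 1%nat -> 0 <= PSeries (PS_derive a) 1.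
Proof.
  intros Ha [_ Hinj] Ha1. apply Rnot_lt_le. intros Hneg.
  set (phi := PSeries a).
  assert (Hd : forall x, is_derive phi x (PSeries (PS_derive a) x)).
  { intros x. apply is_derive_PSeries. now apply entire_CV_radius. }
  assert (Hc : continuity phi).
  { intros x. apply PSeries_continuity. now apply entire_CV_radius. }
  destruct (derive_sign phi 1 _ (Hd 1) ltac:(lra)) as (d1 & Hd1 & H1).
  pose proof (Hd 0) as Hd0. rewrite PSeries_0 in Hd0.
  unfold PS_derive in Hd0 at 1. simpl INR in Hd0. rewrite Rmult_1_l in Hd0.
  destruct (derive_sign phi 0 _ Hd0 ltac:(lra)) as (d0 & Hd0' & H0).
  set (h := Rmin (d1 / 2) (1 / 2)).
  assert (Hh : 0 < h) by (apply Rmin_pos; lra).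
  assert (Hh1 : h <= d1 / 2) by apply Rmin_l. assert (Hh2 : h <= 1 / 2) by apply Rmin_r.
  specialize (H1 (- h)). rewrite Rabs_Ropp, Rabs_pos_eq in H1 by lra.
  specialize (H1 ltac:(lra)).
  assert (Hdown : phi 1 < phi (1 - h)).
  { replace (1 + - h) with (1 - h) in H1 by ring. 
    assert (0 < PSeries (PS_derive a) 1 * - h) by nra. nra. }
  set (k := Rmin (d0 / 2) (1 / 4)).
  assert (Hk : 0 < k) by (apply Rmin_pos; lra).
  assert (Hk1 : k <= d0 / 2) by apply Rmin_l. assert (Hk2 : k <= 1 / 4) by apply Rmin_r.
  specialize (H0 k). rewrite Rabs_pos_eq, Rplus_0_l in H0 by lra.
  specialize (H0 ltac:(lra)).
  assert (Hup : phi 0 < phi k) by (assert (0 < a 1%nat * k) by nra; nra).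
  assert (Hpeak : exists x y z, 0 <= x /\ x < y < z /\ z <= 1 /\ phi x < phi y /\ phi z < phi y).
  { destruct (Rlt_or_le (phi 0) (phi (1 - h))).
    - exists 0, (1 - h), 1. repeat split; lra.
    - exists 0, k, (1 - h). repeat split; lra. }
  destruct Hpeak as (x & y & z & Hx & Hxyz & Hz & Hxy & Hzy).
  destruct (peak_not_injective phi x y z Hxyz Hc Hxy Hzy) as (s & t & Hs & Hst & Ht & E).
  assert (E' : RtoC s = RtoC t).
  { apply Hinj; unfold unit_disk; rewrite ?Cmod_R, ?Rabs_pos_eq by lra; try lra.
    rewrite !cps_RtoC by exact Ha. now f_equal. }
  apply RtoC_inj in E'. lra.
Qed.

(** * Euler's integral *)

Lemma RInt_sub_le (f : R -> R) (a a0 b0 b : R) : 0 < a -> a <= a0 -> a0 <= b0 -> b0 <= b ->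
  (forall t, 0 < t -> continuous f t) -> (forall t, 0 < t -> 0 <= f t) ->
  RInt f a0 b0 <= RInt f a b.
Proof.
  intros Ha H1 H2 H3 Hc Hf.
  assert (Hex : forall x y, 0 < x -> x <= y -> ex_RInt f x y).
  { intros x y Hx Hxy. apply (ex_RInt_continuous (V := R_CompleteNormedModule)).
    intros t Ht. rewrite Rmin_left in Ht by lra. apply Hc. lra. }
  assert (Hpos : forall x y, 0 < x -> x <= y -> 0 <= RInt f x y).
  { intros x y Hx Hxy. apply RInt_ge_0; auto. intros t Ht. apply Hf. lra. }
  rewrite <- (RInt_Chasles f a a0 b) by (apply Hex; lra).
  rewrite <- (RInt_Chasles f a0 b0 b) by (apply Hex; lra).
  pose proof (Hpos a a0 Ha H1). pose proof (Hpos b0 b ltac:(lra) H3).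
  unfold plus; simpl. lra.
Qed.

(** A nonnegative integrand makes the integrals over [a, b] grow with the interval, so they converge
    to their least upper bound. *)
Lemma is_RInt_gen_bounded (f : R -> R) (M : R) :
  (forall t, 0 < t -> continuous f t) -> (forall t, 0 < t -> 0 <= f t) ->
  (forall a b, 0 < a -> a <= b -> RInt f a b <= M) ->
  exists l, is_RInt_gen f (at_right 0) (Rbar_locally p_infty) l
    /\ forall a b, 0 < a -> a <= b -> RInt f a b <= l.
Proof.
  intros Hc Hf HM.
  set (E := fun y => exists a b, 0 < a /\ a <= b /\ y = RInt f a b).
  destruct (completeness E) as (l & Hub & Hlub).
  { exists M. intros y (a & b & Ha & Hab & ->). now apply HM. }
  { exists (RInt f 1 1), 1, 1. repeat split; lra. }
  assert (Hl : forall a b, 0 < a -> a <= b -> RInt f a b <= l).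
  { intros a b Ha Hab. apply Hub. now exists a, b. }
  exists l. split; [|exact Hl].
  intros P (eps & HP).
  assert (Hap : exists a0 b0, 0 < a0 /\ a0 <= b0 /\ l - eps < RInt f a0 b0).
  { apply Classical_Prop.NNPP. intros Hn.
    assert (l <= l - eps); [|pose proof (cond_pos eps); lra].
    apply Hlub. intros y (a & b & Ha & Hab & ->). apply Rnot_lt_le. intros Hc'.
    apply Hn. now exists a, b. }
  destruct Hap as (a0 & b0 & Ha0 & Hab0 & Hlt).
  apply (Filter_prod _ _ _ (fun a => 0 < a < a0) (fun b => b0 < b)).
  - exists (mkposreal _ Ha0). intros y Hy Hy0. split; [exact Hy0|].
    apply Rabs_lt_between' in Hy. simpl in Hy. lra.
  - exists b0. auto.
  - intros a b Ha Hb. exists (RInt f a b). split.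
    + apply (RInt_correct (V := R_CompleteNormedModule)).
      apply (ex_RInt_continuous (V := R_CompleteNormedModule)). simpl.
      intros t Ht. rewrite Rmin_left in Ht by lra. apply Hc. lra.
    + apply HP. change (Rabs (RInt f a b - l) < eps).
      pose proof (Hl a b ltac:(lra) ltac:(lra)).
      pose proof (RInt_sub_le f a a0 b0 b ltac:(lra) ltac:(lra) Hab0 ltac:(lra) Hc Hf).
      rewrite Rabs_left1; lra.
Qed.

Definition gamma_integrand (x t : R) : R := Rpower t (x - 1) * exp (- t).

Lemma gamma_integrand_continuous (x t : R) : 0 < t -> continuous (gamma_integrand x) t.
Proof.
  intros Ht. apply (ex_derive_continuous (V := R_NormedModule)).
  unfold gamma_integrand, Rpower. auto_derive. exact Ht.
Qed.

Lemma gamma_integrand_pos (x t : R) : 0 < gamma_integrand x t.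
Proof. apply Rmult_lt_0_compat; apply exp_pos. Qed.

(** This is exp (- t) <= D (1 + t)^(- x - 1) in logarithmic form.  It holds because ln u <= u - 1 at
    u = (1 + t) / (x + 1). *)
Lemma opp_le_log_majorant (x t : R) : 0 < x -> 0 < t ->
  - t <= ((x + 1) * ln (x + 1) - x) - (x + 1) * ln (1 + t).
Proof.
  intros Hx Ht.
  assert (H : ln ((1 + t) / (x + 1)) <= (1 + t) / (x + 1) - 1).
  { assert (H0 : 0 < (1 + t) / (x + 1)) by (apply Rdiv_lt_0_compat; lra).
    pose proof (exp_ineq1_le (ln ((1 + t) / (x + 1)))) as H1.
    rewrite exp_ln in H1 by exact H0. lra. }
  rewrite ln_div in H by lra.
  apply (Rmult_le_compat_l (x + 1)) in H; [|lra].
  replace ((x + 1) * ((1 + t) / (x + 1) - 1)) with (t - x) in H by (field; lra). lra.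
Qed.

(** The majorant D t^(x-1) (1 + t)^(-x-1) treats both ends of the half line at once: it has the
    bounded antiderivative (D / x) (t / (1 + t))^x. *)
Lemma gamma_integral_bounded (x : R) : 0 < x ->
  exists M, forall a b, 0 < a -> a <= b -> RInt (gamma_integrand x) a b <= M.
Proof.
  intros Hx. set (D := exp ((x + 1) * ln (x + 1) - x)).
  assert (HD : 0 < D) by apply exp_pos.
  set (G := fun t => D / x * exp (x * (ln t - ln (1 + t)))).
  set (g := fun t => D * exp ((x - 1) * ln t - (x + 1) * ln (1 + t))).
  assert (HG : forall t, 0 < t -> is_derive G t (g t)).
  { intros t Ht. unfold G, g. auto_derive; [split; [exact Ht|split; [lra|exact I]]|].
    replace ((x - 1) * ln t - (x + 1) * ln (1 + t))
      with (x * (ln t - ln (1 + t)) + (- ln t + - ln (1 + t))) by ring.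
    rewrite !exp_plus, !exp_Ropp, !exp_ln by lra. unfold Rminus. field. lra. }
  assert (Hgc : forall t, 0 < t -> continuous g t).
  { intros t Ht. apply (ex_derive_continuous (V := R_NormedModule)).
    unfold g. auto_derive. split; [exact Ht|split; [lra|exact I]]. }
  exists (D / x). intros a b Ha Hab.
  apply Rle_trans with (RInt g a b).
  - apply RInt_le; auto.
    + apply (ex_RInt_continuous (V := R_CompleteNormedModule)).
      intros t Ht. rewrite Rmin_left in Ht by lra. apply gamma_integrand_continuous. lra.
    + apply (ex_RInt_continuous (V := R_CompleteNormedModule)).
      intros t Ht. rewrite Rmin_left in Ht by lra. apply Hgc. lra.
    + intros t Ht. unfold gamma_integrand, g, D, Rpower. rewrite <- !exp_plus.
      pose proof (opp_le_log_majorant x t Hx ltac:(lra)) as H.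
      assert (H1 : (x - 1) * ln t + - t <= (x + 1) * ln (x + 1) - x +
        ((x - 1) * ln t - (x + 1) * ln (1 + t))) by lra.
      destruct H1 as [H1|H1]; [left; now apply exp_increasing|rewrite H1; lra].
  - rewrite (is_RInt_unique g a b (G b - G a)).
    + assert (G b <= D / x).
      { unfold G. rewrite <- (Rmult_1_r (D / x)) at 2. apply Rmult_le_compat_l.
        - apply Rlt_le, Rdiv_lt_0_compat; lra.
        - apply Rle_trans with (exp 0); [|rewrite exp_0; lra].
          apply Rlt_le, exp_increasing.
          pose proof (ln_increasing b (1 + b) ltac:(lra) ltac:(lra)). nra. }
      assert (0 < G a).
      { apply Rmult_lt_0_compat; [apply Rdiv_lt_0_compat; lra|apply exp_pos]. }
      lra.
    + apply (is_RInt_derive G g a b); intros t Ht; rewrite Rmin_left in Ht by lra.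
      * apply HG. lra.
      * apply Hgc. lra.
Qed.

Lemma Gamma_spec (x : R) : 0 < x ->
  is_RInt_gen (gamma_integrand x) (at_right 0) (Rbar_locally p_infty) (Gamma x)
  /\ 0 < Gamma x.
Proof.
  intros Hx. destruct (gamma_integral_bounded x Hx) as (M & HM).
  destruct (is_RInt_gen_bounded (gamma_integrand x) M) as (l & Hl & Hlub).
  - intros t. apply gamma_integrand_continuous.
  - intros t _. apply Rlt_le, gamma_integrand_pos.
  - exact HM.
  - replace (Gamma x) with l.
    2: { symmetry. exact (is_RInt_gen_unique (V := R_CompleteNormedModule) _ _ Hl). }
    split; [exact Hl|]. apply Rlt_le_trans with (2 := Hlub 1 2 ltac:(lra) ltac:(lra)).
    apply RInt_gt_0; [lra| |].
    + intros t _. apply gamma_integrand_pos.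
    + intros t Ht. apply gamma_integrand_continuous. lra.
Qed.

Lemma Gamma_pos (x : R) : 0 < x -> 0 < Gamma x.
Proof. intros Hx. now apply Gamma_spec. Qed.

(** Integration by parts: t^x exp (- t) vanishes at both ends. *)
Lemma Gamma_succ (x : R) : 0 < x -> Gamma (x + 1) = x * Gamma x.
Proof.
  intros Hx.
  set (u := fun t => Rpower t x * exp (- t)).
  assert (Hu : forall t, 0 < t ->
    is_derive u t (x * gamma_integrand x t - gamma_integrand (x + 1) t)).
  { intros t Ht. unfold u, gamma_integrand, Rpower. auto_derive; [exact Ht|].
    replace ((x - 1) * ln t) with (x * ln t + - ln t) by ring.
    replace ((x + 1 - 1) * ln t) with (x * ln t) by ring.
    rewrite exp_plus, (exp_Ropp (ln t)), exp_ln by exact Ht. field. lra. }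
  assert (H0 : filterlim u (at_right 0) (locally 0)).
  { intros P (eps & HP).
    assert (Hd : 0 < exp (ln eps / x)) by apply exp_pos.
    exists (mkposreal _ Hd). intros t Ht Ht0. apply HP.
    apply Rabs_lt_between' in Ht. simpl in Ht.
    change (Rabs (u t - 0) < eps).
    assert (Hup : 0 < u t) by (apply Rmult_lt_0_compat; apply exp_pos).
    rewrite Rminus_0_r, Rabs_pos_eq by lra.
    apply Rle_lt_trans with (Rpower t x).
    - unfold u. rewrite <- (Rmult_1_r (Rpower t x)) at 2.
      apply Rmult_le_compat_l; [apply Rlt_le, exp_pos|].
      rewrite <- exp_0. apply Rlt_le, exp_increasing. lra.
    - unfold Rpower. rewrite <- (exp_ln eps) by apply eps. apply exp_increasing.
      assert (ln t < ln eps / x).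
      { rewrite <- (ln_exp (ln eps / x)). apply ln_increasing; lra. }
      apply Rlt_div_r in H; [|exact Hx]. lra. }
  assert (Hinf : filterlim u (Rbar_locally p_infty) (locally 0)).
  { intros P (eps & HP). set (D := exp ((x + 1) * ln (x + 1) - x)).
    assert (HD : 0 < D) by apply exp_pos.
    exists (Rmax 0 (D / eps)). intros t Ht. apply HP.
    pose proof (Rmax_l 0 (D / eps)). pose proof (Rmax_r 0 (D / eps)).
    change (Rabs (u t - 0) < eps).
    assert (Hup : 0 < u t) by (apply Rmult_lt_0_compat; apply exp_pos).
    rewrite Rminus_0_r, Rabs_pos_eq by lra.
    apply Rle_lt_trans with (D / (1 + t)).
    - unfold u, D, Rpower, Rdiv. rewrite <- (exp_ln (1 + t)) at 1 by lra.
      rewrite <- exp_Ropp, <- !exp_plus.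
      pose proof (opp_le_log_majorant x t Hx ltac:(lra)).
      pose proof (ln_increasing t (1 + t) ltac:(lra) ltac:(lra)).
      apply Rlt_le, exp_increasing. nra.
    - apply Rlt_div_l; [lra|].
      assert (Hlt : D / eps < t) by lra. apply Rlt_div_l in Hlt; [|apply eps].
      pose proof (cond_pos eps). nra. }
  assert (Hpos : forall Q : R -> Prop, (forall t, 0 < t -> Q t) ->
    filter_prod (at_right 0) (Rbar_locally p_infty)
      (fun ab : R * R => forall t, Rmin (fst ab) (snd ab) <= t <= Rmax (fst ab) (snd ab) -> Q t)).
  { intros Q HQ. apply (Filter_prod _ _ _ (fun a => 0 < a) (fun b => 0 < b)).
    - exists (mkposreal 1 Rlt_0_1). auto.
    - exists 0. auto.
    - intros a b Ha Hb t Ht. apply HQ. simpl in Ht.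
      apply Rlt_le_trans with (2 := proj1 Ht). now apply Rmin_glb_lt. }
  assert (HI : is_RInt_gen (Derive u) (at_right 0) (Rbar_locally p_infty) (0 - 0)).
  { apply is_RInt_gen_Derive; auto.
    - apply Hpos. intros t Ht. eexists. now apply Hu.
    - apply (Hpos (fun t => continuous (Derive u) t)). intros t Ht.
      apply continuous_ext_loc with
        (fun t => x * gamma_integrand x t - gamma_integrand (x + 1) t).
      + exists (mkposreal _ Ht). intros y Hy. apply Rabs_lt_between' in Hy. simpl in Hy.
        symmetry. apply is_derive_unique, Hu. lra.
      + apply (continuous_minus (V := R_NormedModule)).
        * apply (continuous_scal_r (V := R_NormedModule)). now apply gamma_integrand_continuous.
        * now apply gamma_integrand_continuous. }
  destruct (Gamma_spec x Hx) as [H1 _]. destruct (Gamma_spec (x + 1) ltac:(lra)) as [H2 _].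
  pose proof (is_RInt_gen_minus (V := R_NormedModule) _ _ _ _
    (is_RInt_gen_scal (V := R_NormedModule) _ x _ H1) H2) as H3.
  assert (H4 : is_RInt_gen (Derive u) (at_right 0) (Rbar_locally p_infty)
     (minus (scal x (Gamma x)) (Gamma (x + 1)))).
  { revert H3. apply is_RInt_gen_ext.
    eapply filter_imp; [|apply (Hpos (fun t =>
      x * gamma_integrand x t - gamma_integrand (x + 1) t = Derive u t))].
    - intros ab H t Ht. apply H. lra.
    - intros t Ht. symmetry. now apply is_derive_unique, Hu. }
  pose proof (is_RInt_gen_unique (V := R_CompleteNormedModule) _ _ HI) as E1.
  pose proof (is_RInt_gen_unique (V := R_CompleteNormedModule) _ _ H4) as E2.
  rewrite E1 in E2. unfold minus, plus, opp, scal in E2; simpl in E2.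
  unfold mult in E2; simpl in E2. lra.
Qed.

(** * Coefficients of the Dini function *)

Lemma entire_exp : entire (fun n => / INR (fact n)).
Proof.
  intros r Hr. exists (exp r).
  eapply is_series_ext; [|exact (proj1 (is_pseries_R _ _ _) (is_exp_Reals r))].
  intros n. cbv beta. rewrite Rabs_pos_eq; [reflexivity|].
  apply Rlt_le, Rinv_0_lt_compat, INR_fact_lt_0.
Qed.

Fixpoint rising (x : R) (n : nat) : R :=
  match n with
  | O => 1
  | S n' => rising x n' * (x + INR n')
  end.

Lemma rising_pos (x : R) n : 0 < x -> 0 < rising x n.
Proof.
  intros Hx. induction n as [|n IH]; simpl; [lra|].
  apply Rmult_lt_0_compat; [exact IH|]. pose proof (pos_INR n). lra.
Qed.

Lemma Gamma_rising (x : R) n : 0 < x -> Gamma (x + INR n) = rising x n * Gamma x.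
Proof.
  intros Hx. induction n as [|n IH].
  - simpl. rewrite Rplus_0_r. ring.
  - rewrite S_INR, <- Rplus_assoc, Gamma_succ, IH by (pose proof (pos_INR n); lra).
    simpl. ring.
Qed.

(** Up to the factor 2^(-nu) / Gamma (nu + 1), these are the coefficients of J_nu(x) x^(-nu) in x^2. *)
Definition bessel_coef (nu : R) (n : nat) : R :=
  (-1) ^ n / (4 ^ n * INR (fact n) * rising (nu + 1) n).

Lemma bessel_coef_S (nu : R) n : -1 < nu ->
  4 * INR (S n) * (nu + 1 + INR n) * bessel_coef nu (S n) = - bessel_coef nu n.
Proof.
  intros Hnu. unfold bessel_coef. rewrite fact_simpl, mult_INR. simpl rising. simpl pow.
  pose proof (rising_pos (nu + 1) n ltac:(lra)). pose proof (pos_INR n).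
  pose proof (INR_fact_lt_0 n). pose proof (pow_lt 4 n ltac:(lra)).
  assert (0 < INR (S n)) by (apply lt_0_INR; lia).
  field. repeat split; lra.
Qed.

Lemma dini_coef_bessel (nu : R) n : -1 < nu ->
  dini_coef nu n = (2 * INR n + 1) * bessel_coef nu n.
Proof.
  intros Hnu. unfold dini_coef, bessel_coef.
  replace (nu + INR n + 1) with (nu + 1 + INR n) by ring.
  rewrite Gamma_rising by lra.
  pose proof (rising_pos (nu + 1) n ltac:(lra)).
  pose proof (INR_fact_lt_0 n). pose proof (pow_lt 4 n ltac:(lra)).
  pose proof (Gamma_pos (nu + 1) ltac:(lra)).
  field. repeat split; lra.
Qed.

Lemma bessel_coef_entire (nu : R) : -1 < nu -> entire (bessel_coef nu).
Proof.
  intros Hnu. set (k := / (4 * (nu + 1))).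
  assert (Hk : 0 < k) by (apply Rinv_0_lt_compat; lra).
  apply (entire_geometric (fun n => / INR (fact n)) _ k (Rlt_le _ _ Hk) entire_exp).
  intros n. rewrite (Rabs_pos_eq (/ INR (fact n))).
  2: { apply Rlt_le, Rinv_0_lt_compat, INR_fact_lt_0. }
  unfold bessel_coef, Rdiv. rewrite Rabs_mult, pow_1_abs, Rmult_1_l.
  pose proof (INR_fact_lt_0 n).  pose proof (pow_lt 4 n ltac:(lra)).
  assert (Hr : (nu + 1) ^ n <= rising (nu + 1) n).
  { clear - Hnu. induction n as [|n IH]; simpl; [lra|].
    rewrite Rmult_comm. pose proof (pos_INR n). pose proof (pow_le (nu + 1) n ltac:(lra)).
    apply Rmult_le_compat; lra. }
  pose proof (pow_lt (nu + 1) n ltac:(lra)).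
  rewrite Rabs_pos_eq.
  2: { apply Rlt_le, Rinv_0_lt_compat. apply Rmult_lt_0_compat; [apply Rmult_lt_0_compat|]; lra. }
  unfold k. rewrite pow_inv, Rpow_mult_distr, <- Rinv_mult.
  apply Rinv_le_contravar.
  - apply Rmult_lt_0_compat; [apply Rmult_lt_0_compat|]; lra.
  - assert (0 < 4 ^ n * INR (fact n)) by (apply Rmult_lt_0_compat; lra). nra.
Qed.

Lemma dini_coef_entire (nu : R) : -1 < nu -> entire (dini_coef nu).
Proof.
  intros Hnu.
  apply (entire_geometric (bessel_coef nu) _ 3 ltac:(lra) (bessel_coef_entire nu Hnu)).
  intros n. rewrite dini_coef_bessel, Rabs_mult by exact Hnu.
  apply Rmult_le_compat_r; [apply Rabs_pos|].
  pose proof (pos_INR n). rewrite Rabs_pos_eq by lra.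
  clear. induction n as [|n IH]; [simpl; lra|]. rewrite S_INR. simpl.
  pose proof (pos_INR n). lra.
Qed.

Lemma dini_r_cps (nu : R) : -1 < nu -> dini_r nu = cps (PS_incr_1 (dini_coef nu)).
Proof.
  intros Hnu. apply functional_extensionality. intros z.
  pose proof (dini_coef_entire nu Hnu) as Hp.
  rewrite cps_PS_incr_1 by exact Hp.
  apply iota_series.
  eapply is_series_ext; [|apply (is_series_scal (V := C_NormedModule) z _ _ (cps_correct _ z Hp))].
  intros n. change ((z * (RtoC (dini_coef nu n) * z ^ n))%C = (RtoC (dini_coef nu n) * (z * z ^ n))%C). ring.
Qed.

Lemma dini_coef_0 nu : -1 < nu -> dini_coef nu 0 = 1.
Proof. intros Hnu. rewrite dini_coef_bessel by exact Hnu. unfold bessel_coef. simpl. field. Qed.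

Lemma dini_coef_S (nu : R) n : -1 < nu ->
  dini_coef nu (S n) = - ((2 * INR n + 3) / ((2 * INR n + 1) * (4 * (INR n + 1) * (nu + 1 + INR n))))
                         * dini_coef nu n.
Proof.
  intros Hnu. rewrite !dini_coef_bessel by exact Hnu.
  pose proof (bessel_coef_S nu n Hnu) as H. rewrite S_INR in *. pose proof (pos_INR n).
  replace (bessel_coef nu n) with (- (4 * (INR n + 1) * (nu + 1 + INR n) * bessel_coef nu (S n))) by lra.
  field. repeat split; lra.
Qed.

Lemma dini_coef_neq_0 nu n : -1 < nu -> dini_coef nu n <> 0.
Proof.
  intros Hnu. induction n as [|n IH]; [rewrite dini_coef_0; lra|].
  rewrite dini_coef_S by exact Hnu. pose proof (pos_INR n).
  apply Rmult_integral_contrapositive_currified; [|exact IH].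
  apply Ropp_neq_0_compat, Rgt_not_eq, Rdiv_lt_0_compat; [lra|].
  apply Rmult_lt_0_compat; [lra|]. apply Rmult_lt_0_compat; lra.
Qed.

Lemma Rabs_dini_coef_S (nu : R) n : -1 < nu ->
  (2 * INR n + 1) * (4 * (INR n + 1) * (nu + 1 + INR n)) * Rabs (dini_coef nu (S n))
    = (2 * INR n + 3) * Rabs (dini_coef nu n).
Proof.
  intros Hnu. rewrite dini_coef_S, Rabs_mult, Rabs_Ropp by exact Hnu. pose proof (pos_INR n).
  assert (0 < (2 * INR n + 1) * (4 * (INR n + 1) * (nu + 1 + INR n))).
  { apply Rmult_lt_0_compat; [lra|]. apply Rmult_lt_0_compat; lra. }
  rewrite Rabs_pos_eq by (apply Rdiv_le_0_compat; lra). field. repeat split; lra.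
Qed.

(** The terms n^2 (n + 1) |p_n| decrease at least as 4^(-n) from n = 2 on, and the first of them is
    at most 5/4 |p_1|; their sum is at most 5/3 |p_1|, against |q_1| = 2 |p_1|. *)
Lemma dini_second_moment (nu : R) : 0 <= nu ->
  tail_moment 2 (PS_derive (PS_incr_1 (dini_coef nu)))
    <= - PS_derive (PS_incr_1 (dini_coef nu)) 1%nat.
Proof.
  intros Hnu. set (p := dini_coef nu).
  assert (Hq : forall n, PS_derive (PS_incr_1 p) n = INR (S n) * p n) by reflexivity.
  assert (Hp1 : p 1%nat = - Rabs (p 1%nat)).
  { unfold p. rewrite dini_coef_S, dini_coef_0 by lra. simpl.
    assert (0 < (2 * 0 + 3) / ((2 * 0 + 1) * (4 * (0 + 1) * (nu + 1 + 0)))).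
    { apply Rdiv_lt_0_compat; lra. }
    rewrite Rabs_left by lra. lra. }
  apply Rle_trans with (5 / 4 * Rabs (p 1%nat) / (1 - 1 / 4)).
  - apply tail_moment_geometric; [lra| |].
    + rewrite Hq, Rabs_mult, Rabs_pos_eq by apply pos_INR.
      pose proof (Rabs_dini_coef_S nu 1 ltac:(lra)) as H. fold p in H. simpl in *.
      pose proof (Rabs_pos (p 2%nat)). nra.
    + intros n Hn. rewrite !Hq, !Rabs_mult, !(Rabs_pos_eq (INR _)) by apply pos_INR.
      pose proof (Rabs_dini_coef_S nu n ltac:(lra)) as H. fold p in H.
      pose proof (INR_ge_2 n Hn) as H2. rewrite !S_INR.
      pose proof (Rabs_pos (p n)). pose proof (Rabs_pos (p (S n))).
      set (x := INR n) in *. set (u := Rabs (p (S n))) in *. set (v := Rabs (p n)) in *.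
      apply Rmult_le_reg_l with (2 * x + 3); [lra|].
      replace ((2 * x + 3) * (1 / 4 * (x ^ 2 * ((x + 1) * v))))
        with (1 / 4 * (x ^ 2 * (x + 1)) * ((2 * x + 3) * v)) by ring.
      rewrite <- H.
      assert (Hpoly : (2 * x + 3) * ((x + 1) ^ 2 * (x + 1 + 1))
         <= 1 / 4 * (x ^ 2 * (x + 1)) * ((2 * x + 1) * (4 * (x + 1) * (1 + x)))).
      { assert ((2 * x + 3) * (x + 2) <= x ^ 2 * (2 * x + 1) * (x + 1)) by nra.
        assert (0 <= (x + 1) ^ 2) by apply pow2_ge_0. nra. }
      assert (Hmono : 1 / 4 * (x ^ 2 * (x + 1)) * ((2 * x + 1) * (4 * (x + 1) * (1 + x)))
        <= 1 / 4 * (x ^ 2 * (x + 1)) * ((2 * x + 1) * (4 * (x + 1) * (nu + 1 + x)))).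
      { apply Rmult_le_compat_l; [nra|]. apply Rmult_le_compat_l; [lra|].
        apply Rmult_le_compat_l; lra. }
      assert ((2 * x + 3) * ((x + 1) ^ 2 * (x + 1 + 1)) * u <=
        1 / 4 * (x ^ 2 * (x + 1)) * ((2 * x + 1) * (4 * (x + 1) * (nu + 1 + x))) * u)
        by (apply Rmult_le_compat_r; lra).
      lra.
  - rewrite Hq. simpl. pose proof (Rabs_pos (p 1%nat)). lra.
Qed.

(** Successive terms m |g_m| have ratio at most 5/16, attained for nu = 0 and
    k = m = 1, so the tail is at most 5/11 of the first term. *)
Lemma dini_derivative_dominant (nu : R) (k : nat) : 0 <= nu -> (1 <= k)%nat ->
  tail_moment 1 (PS_derive_n k (PS_incr_1 (dini_coef nu)))
    < Rabs (PS_derive_n k (PS_incr_1 (dini_coef nu)) 1%nat).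
Proof.
  intros Hnu Hk. destruct k as [|j]; [lia|].
  set (g := PS_derive_n (S j) (PS_incr_1 (dini_coef nu))).
  set (p := dini_coef nu).
  assert (Hg : forall m, g m = INR (fact (m + S j)) / INR (fact m) * p (m + j)%nat).
  { intros m. unfold g, PS_derive_n. now rewrite <- plus_n_Sm. }
  assert (Hg1 : 0 < Rabs (g 1%nat)).
  { apply Rabs_pos_lt. rewrite Hg. apply Rmult_integral_contrapositive_currified.
    - apply Rgt_not_eq, Rdiv_lt_0_compat; apply INR_fact_lt_0.
    - apply dini_coef_neq_0. lra. }
  assert (Hratio : forall m, (1 <= m)%nat ->
     INR (S m) ^ 1 * Rabs (g (S m)) <= 5 / 16 * (INR m ^ 1 * Rabs (g m))).
  { intros m Hm. rewrite !pow_1, !Hg, !Rabs_mult.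
    rewrite !(Rabs_pos_eq (_ / _)) by (apply Rlt_le, Rdiv_lt_0_compat; apply INR_fact_lt_0).
    pose proof (Rabs_dini_coef_S nu (m + j) ltac:(lra)) as H. fold p in H.
    change (S m + j)%nat with (S (m + j)).
    replace (S m + S j)%nat with (S (m + S j)) by lia.
    rewrite !fact_simpl, !mult_INR, !S_INR.
    replace (INR (m + S j)) with (INR (m + j) + 1) by (rewrite <- S_INR; f_equal; lia).
    assert (Hx1 : 1 <= INR m) by (change 1 with (INR 1); now apply le_INR).
    assert (Hx : 1 <= INR (m + j)) by (change 1 with (INR 1); apply le_INR; lia).
    set (x := INR (m + j)) in *.
    pose proof (INR_fact_lt_0 m). pose proof (INR_fact_lt_0 (m + S j)).
    set (F := INR (fact (m + S j))) in *. set (f := INR (fact m)) in *.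
    pose proof (Rabs_pos (p (m + j)%nat)). pose proof (Rabs_pos (p (S (m + j)))).
    set (u := Rabs (p (S (m + j)))) in *. set (v := Rabs (p (m + j)%nat)) in *.
    replace ((INR m + 1) * ((x + 1 + 1) * F / ((INR m + 1) * f) * u))
      with (F / f * ((x + 2) * u)) by (field; lra).
    replace (5 / 16 * (INR m * (F / f * v))) with (F / f * (5 / 16 * INR m * v)) by (field; lra).
    apply Rmult_le_compat_l; [apply Rlt_le, Rdiv_lt_0_compat; lra|].
    apply Rle_trans with (5 / 16 * v); [|nra].
    apply Rmult_le_reg_l with (2 * x + 3); [lra|].
    replace ((2 * x + 3) * (5 / 16 * v)) with (5 / 16 * ((2 * x + 3) * v)) by ring.
    rewrite <- H.
    assert (Hpoly : (2 * x + 3) * (x + 2)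
       <= 5 / 16 * ((2 * x + 1) * (4 * (x + 1) * (1 + x)))) by nra.
    assert (Hmono : (2 * x + 1) * (4 * (x + 1) * (1 + x)) <= (2 * x + 1) * (4 * (x + 1) * (nu + 1 + x))).
    { apply Rmult_le_compat_l; [lra|]. apply Rmult_le_compat_l; lra. }
    assert ((2 * x + 3) * (x + 2) * u <= 5 / 16 * ((2 * x + 1) * (4 * (x + 1) * (nu + 1 + x))) * u)
      by (apply Rmult_le_compat_r; lra).
    lra. }
  apply Rle_lt_trans with (5 / 16 * Rabs (g 1%nat) / (1 - 5 / 16)); [|lra].
  apply tail_moment_geometric; [lra| |].
  - specialize (Hratio 1%nat (le_n _)). simpl INR in *. simpl pow in *. lra.
  - intros n Hn. apply Hratio. lia.
Qed.

(** * The derivative at 1 as a function of the order *)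

Definition dini_slope (nu : R) : R := PSeries (PS_derive (PS_incr_1 (dini_coef nu))) 1.

Lemma is_series_dini_slope (nu : R) : -1 < nu ->
  is_series (fun n => INR (S n) * dini_coef nu n) (dini_slope nu).
Proof.
  intros Hnu.
  assert (He : entire (PS_derive (PS_incr_1 (dini_coef nu)))).
  { now apply entire_PS_derive, entire_PS_incr_1, dini_coef_entire. }
  eapply is_series_ext; [|exact (entire_is_series _ 1 He)].
  intros n. cbv beta. rewrite pow1, Rmult_1_r. reflexivity.
Qed.

(** With t the Bessel coefficients, q_n = (n + 1) (2 n + 1) t_n and
    (n + 1) (2 n + 1) = 2 n (n + nu) + (3 - 2 nu) n + 1.  The first part telescopes to minus half
    of the sum of t, and the sum of n t_n is a multiple of J_(nu+1)(1). *)
Lemma bessel_combination (nu : R) : -1 < nu ->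
  bessel_J nu 1 - (3 - 2 * nu) * bessel_J (nu + 1) 1
    = 2 * (Rpower (1 / 2) nu / Gamma (nu + 1)) * dini_slope nu.
Proof.
  intros Hnu. set (C0 := Rpower (1 / 2) nu / Gamma (nu + 1)). set (t := bessel_coef nu).
  pose proof (bessel_coef_entire nu Hnu) as Ht.
  pose proof (Gamma_pos (nu + 1) ltac:(lra)) as HG.
  assert (Hex : forall a, entire a -> is_series a (PSeries a 1)).
  { intros a Ha. eapply is_series_ext; [|exact (entire_is_series _ 1 Ha)].
    intros n. cbv beta. rewrite pow1, Rmult_1_r. reflexivity. }
  set (T0 := PSeries t 1). set (T1 := PSeries (fun n => INR n * t n) 1).
  pose proof (Hex _ Ht) as H0. fold t T0 in H0.
  pose proof (Hex _ (entire_INR_mult _ Ht)) as H1. fold t T1 in H1.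
  assert (H1' : is_series (fun n => INR (S n) * t (S n)) T1).
  { apply (is_series_incr_1 (V := R_NormedModule) (fun n => INR n * t n)).
    replace (plus _ _) with T1; [exact H1|]. unfold plus; simpl. ring. }
  assert (Hpow : forall x n, Rpower (1 / 2) (2 * INR n + x) = Rpower (1 / 2) x / 4 ^ n).
  { intros x n. rewrite Rpower_plus.
    replace (2 * INR n) with (INR (2 * n)) by (rewrite mult_INR; simpl; ring).
    rewrite Rpower_pow by lra. rewrite pow_mult.
    replace ((1 / 2) ^ 2) with (/ 4) by field. rewrite pow_inv. unfold Rdiv. ring. }
  assert (HJ0 : bessel_J nu 1 = C0 * T0).
  { unfold bessel_J. apply is_series_unique.
    eapply is_series_ext; [|apply (is_series_scal (V := R_NormedModule) C0 _ _ H0)].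
    intros n. rewrite Hpow. change (scal C0 (t n)) with (C0 * t n).
    unfold C0, t, bessel_coef. replace (nu + INR n + 1) with (nu + 1 + INR n) by ring.
    rewrite Gamma_rising by lra.
    pose proof (rising_pos (nu + 1) n ltac:(lra)).
    pose proof (INR_fact_lt_0 n). pose proof (pow_lt 4 n ltac:(lra)).
    match goal with |- @eq _ ?a ?b => change (@eq R a b) end.
    field. repeat split; lra. }
  assert (HJ1 : bessel_J (nu + 1) 1 = - 2 * C0 * T1).
  { unfold bessel_J. apply is_series_unique.
    eapply is_series_ext; [|apply (is_series_scal (V := R_NormedModule) (- 2 * C0) _ _ H1')].
    intros n. rewrite Hpow.
    change (scal (- 2 * C0) (INR (S n) * t (S n))) with (- 2 * C0 * (INR (S n) * t (S n))).
    unfold C0, t, bessel_coef.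
    replace (nu + 1 + INR n + 1) with (nu + 1 + INR (S n)) by (rewrite S_INR; ring).
    rewrite Gamma_rising by lra. rewrite Rpower_plus, Rpower_1 by lra.
    pose proof (rising_pos (nu + 1) (S n) ltac:(lra)).
    pose proof (INR_fact_lt_0 n). pose proof (pow_lt 4 n ltac:(lra)).
    rewrite fact_simpl, mult_INR. simpl pow.
    assert (0 < INR (S n)) by (apply lt_0_INR; lia).
    match goal with |- @eq _ ?a ?b => change (@eq R a b) end. field. repeat split; lra. }
  (* By [bessel_coef_S] the n-th term is - t (n - 1) / 4, so multiplying t by n (n + nu)
     shifts its sum by one place. *)
  assert (Htel : is_series (fun n => INR n * (INR n + nu) * t n) (- / 4 * T0)).
  { apply is_series_decr_1.
    replace (plus _ _) with (- / 4 * T0) by (unfold plus, opp; simpl; ring).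
    eapply is_series_ext; [|apply (is_series_scal (V := R_NormedModule) (- / 4) _ _ H0)].
    intros n. change (- / 4 * t n = INR (S n) * (INR (S n) + nu) * t (S n)).
    pose proof (bessel_coef_S nu n Hnu) as H. fold t in H. rewrite !S_INR in *. lra. }
  assert (HS : dini_slope nu = T0 / 2 + (3 - 2 * nu) * T1).
  { pose proof (is_series_dini_slope nu Hnu) as HS.
    rewrite <- (is_series_unique _ _ HS). apply is_series_unique.
    pose proof (is_series_plus (V := R_NormedModule) _ _ _ _
      (is_series_scal (V := R_NormedModule) 2 _ _ Htel)
      (is_series_plus (V := R_NormedModule) _ _ _ _
        (is_series_scal (V := R_NormedModule) (3 - 2 * nu) _ _ H1) H0)) as Hs.
    replace (T0 / 2 + (3 - 2 * nu) * T1) with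
      (plus (scal 2 (- / 4 * T0)) (plus (scal (3 - 2 * nu) T1) T0)).
    2: { unfold plus, scal; simpl. unfold mult; simpl. field. }
    eapply is_series_ext; [|exact Hs].
    intros n. rewrite dini_coef_bessel by exact Hnu. fold t. rewrite S_INR.
    unfold plus, scal; simpl. unfold mult; simpl. ring. }
  rewrite HJ0, HJ1, HS. field.
Qed.

(** The factor of the term n + 2 of (nu + 1) r'(1) that does not depend on nu. *)
Definition scaled_weight (n : nat) : R :=
  (-1) ^ n * (INR n + 3) * (2 * INR n + 5) / (4 ^ S (S n) * INR (fact (S (S n)))).

(** The factor nu + 1 removes the pole at nu = -1, and the two leading terms become
    nu + 1 and - 3/2, whence nu - 1/2. *)
Lemma dini_slope_expand (nu : R) : -1 < nu ->
  is_series (fun n => scaled_weight n * / rising (nu + 2) (S n))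
    ((nu + 1) * dini_slope nu - (nu - 1 / 2)).
Proof.
  intros Hnu. pose proof (is_series_dini_slope nu Hnu) as H.
  apply (is_series_scal (V := R_NormedModule) (nu + 1)) in H.
  set (u := fun n => (nu + 1) * (INR (S n) * dini_coef nu n)).
  assert (H0 : u 0%nat = nu + 1).
  { unfold u. rewrite dini_coef_0 by exact Hnu. simpl. ring. }
  assert (H1 : u 1%nat = - (3 / 2)).
  { unfold u. rewrite dini_coef_S, dini_coef_0 by exact Hnu. simpl. field. lra. }
  assert (Hs : is_series (fun n => u (S (S n))) ((nu + 1) * dini_slope nu - (nu - 1 / 2))).
  { apply (is_series_incr_1 (V := R_NormedModule) (fun n => u (S n))).
    apply (is_series_incr_1 (V := R_NormedModule) u).
    match goal with |- is_series _ ?x => replace x with ((nu + 1) * dini_slope nu) end; [exact H|].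
    rewrite H0, H1. unfold plus; simpl. field. }
  eapply is_series_ext; [|exact Hs]. intros n. unfold u.
  rewrite dini_coef_bessel by exact Hnu. unfold bessel_coef, scaled_weight.
  assert (Hr : forall m, rising (nu + 1) (S m) = (nu + 1) * rising (nu + 2) m).
  { induction m as [|m IH]; [simpl; ring|].
    change (rising (nu + 1) (S (S m))) with (rising (nu + 1) (S m) * (nu + 1 + INR (S m))).
    rewrite IH, S_INR. simpl. ring. }
  rewrite Hr, !S_INR. replace ((-1) ^ S (S n)) with ((-1) ^ n) by (simpl; ring).
  pose proof (rising_pos (nu + 2) (S n) ltac:(lra)).
  pose proof (INR_fact_lt_0 (S (S n))). pose proof (pow_lt 4 (S (S n)) ltac:(lra)).
  match goal with |- @eq _ ?a ?b => change (@eq R a b) end.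
  field. repeat split; lra.
Qed.

(** A product of n factors 1 / (x + i), each with values in (0, 1] and Lipschitz constant 1. *)
Lemma inv_rising_lipschitz (x y : R) n : 1 < x -> 1 < y ->
  Rabs (/ rising x n - / rising y n) <= INR n * Rabs (x - y).
Proof.
  intros Hx Hy.
  assert (Hb : forall z m, 1 < z -> 0 < / rising z m <= 1).
  { intros z m Hz. assert (1 <= rising z m).
    { induction m as [|m IH]; simpl; [lra|]. pose proof (pos_INR m). nra. }
    split; [apply Rinv_0_lt_compat; lra|]. rewrite <- Rinv_1. apply Rinv_le_contravar; lra. }
  induction n as [|n IH].
  - simpl. rewrite Rminus_diag, Rabs_R0. lra.
  - simpl rising. rewrite !Rinv_mult. pose proof (pos_INR n).
    set (a := / rising x n) in *. set (b := / rising y n) in *.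
    pose proof (Hb y n Hy) as Hbb. fold b in Hbb.
    assert (Hix : 0 < / (x + INR n) <= 1).
    { split; [apply Rinv_0_lt_compat; lra|]. rewrite <- Rinv_1. apply Rinv_le_contravar; lra. }
    assert (Hiy : 0 < / (y + INR n) <= 1).
    { split; [apply Rinv_0_lt_compat; lra|]. rewrite <- Rinv_1. apply Rinv_le_contravar; lra. }
    replace (a * / (x + INR n) - b * / (y + INR n)) with
      ((a - b) * / (x + INR n) + b * (/ (x + INR n) * / (y + INR n)) * (y - x))
      by (field; lra).
    apply Rle_trans with (1 := Rabs_triang _ _).
    rewrite !Rabs_mult, (Rabs_minus_sym y x), (Rabs_pos_eq b), !(Rabs_pos_eq (/ _)) by lra.
    rewrite S_INR. pose proof (Rabs_pos (a - b)). pose proof (Rabs_pos (x - y)).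
    assert (Rabs (a - b) * / (x + INR n) <= Rabs (a - b) * 1) by (apply Rmult_le_compat_l; lra).
    set (i := / (x + INR n)) in *. set (k := / (y + INR n)) in *.
    assert (0 <= i * k <= 1).
    { split; [apply Rmult_le_pos; lra|]. rewrite <- (Rmult_1_r 1). apply Rmult_le_compat; lra. }
    assert (b * (i * k) <= 1).
    { rewrite <- (Rmult_1_r 1). apply Rmult_le_compat; lra. }
    assert (b * (i * k) * Rabs (x - y) <= 1 * Rabs (x - y)) by (now apply Rmult_le_compat_r).
    lra.
Qed.

Lemma scaled_weight_bound n : INR (S n) * Rabs (scaled_weight n) <= 15 / 32 * (1 / 3) ^ n.
Proof.
  assert (Habs : forall n, Rabs (scaled_weight n) =
    (INR n + 3) * (2 * INR n + 5) / (4 ^ S (S n) * INR (fact (S (S n))))).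
  { clear. intros n. unfold scaled_weight, Rdiv. pose proof (pos_INR n).
    pose proof (INR_fact_lt_0 (S (S n))). pose proof (pow_lt 4 (S (S n)) ltac:(lra)).
    rewrite !Rabs_mult, pow_1_abs, Rmult_1_l, !Rabs_pos_eq; try lra.
    apply Rlt_le, Rinv_0_lt_compat. now apply Rmult_lt_0_compat. }
  induction n as [|n IH].
  - rewrite Habs. simpl. lra.
  - rewrite Habs in *. change (4 ^ S (S (S n))) with (4 * 4 ^ S (S n)).
    change ((1 / 3) ^ S n) with (1 / 3 * (1 / 3) ^ n).
    rewrite (fact_simpl (S (S n))), mult_INR, !S_INR in *.
    pose proof (pos_INR n).
    pose proof (INR_fact_lt_0 (S (S n))). pose proof (pow_lt 4 (S (S n)) ltac:(lra)).
    set (F := INR (fact (S (S n)))) in *. set (P := 4 ^ S (S n)) in *. set (x := INR n) in *.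
    apply Rle_trans with (1 / 3 * ((x + 1) * ((x + 3) * (2 * x + 5) / (P * F)))); [|lra].
    apply Rmult_le_reg_l with (P * F * (x + 1 + 1 + 1)).
    { apply Rmult_lt_0_compat; [now apply Rmult_lt_0_compat|lra]. }
    replace (P * F * (x + 1 + 1 + 1) *
      ((x + 1 + 1) * ((x + 1 + 3) * (2 * (x + 1) + 5) / (4 * P * ((x + 1 + 1 + 1) * F)))))
     with ((x + 2) * (x + 4) * (2 * x + 7) / 4) by (field; repeat split; lra).
    replace (P * F * (x + 1 + 1 + 1) * (1 / 3 * ((x + 1) * ((x + 3) * (2 * x + 5) / (P * F)))))
     with ((x + 3) * (x + 1) * (x + 3) * (2 * x + 5) / 3) by (field; lra).
    assert (0 <= x ^ 2) by apply pow2_ge_0. assert (0 <= x ^ 3) by (now apply pow_le).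
    assert (0 <= x ^ 4) by (now apply pow_le). nra.
Qed.

(** The Lipschitz constants of the terms add up to at most 15/32 (1 + 1/3 + 1/9 + ...) = 45/64; that
    this is less than 1 gives monotonicity, that it is finite gives continuity. *)
Lemma scaled_slope_near_identity (x y : R) : -1 < x -> -1 < y ->
  Rabs (((x + 1) * dini_slope x - (y + 1) * dini_slope y) - (x - y)) <= 45 / 64 * Rabs (x - y).
Proof.
  intros Hx Hy.
  pose proof (is_series_minus (V := R_NormedModule) _ _ _ _
    (dini_slope_expand x Hx) (dini_slope_expand y Hy)) as H.
  set (w := fun n => scaled_weight n * (/ rising (x + 2) (S n) - / rising (y + 2) (S n))).
  set (L := (x + 1) * dini_slope x - (y + 1) * dini_slope y - (x - y)).
  assert (Hw : is_series w L).
  { replace L with (plus ((x + 1) * dini_slope x - (x - 1 / 2))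
      (opp ((y + 1) * dini_slope y - (y - 1 / 2)))).
    2: { unfold plus, opp, L; simpl. ring. }
    eapply is_series_ext; [|exact H]. intros n. unfold plus, opp, w; simpl. ring. }
  rewrite <- (is_series_unique _ _ Hw).
  assert (Hb : forall n, 0 <= Rabs (w n) <= 15 / 32 * Rabs (x - y) * (1 / 3) ^ n).
  { intros n. split; [apply Rabs_pos|]. unfold w. rewrite Rabs_mult.
    pose proof (inv_rising_lipschitz (x + 2) (y + 2) (S n) ltac:(lra) ltac:(lra)) as H1.
    replace (x + 2 - (y + 2)) with (x - y) in H1 by ring.
    pose proof (scaled_weight_bound n) as H2.
    pose proof (Rabs_pos (scaled_weight n)). pose proof (Rabs_pos (x - y)).
    apply Rle_trans with (Rabs (scaled_weight n) * (INR (S n) * Rabs (x - y))).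
    - now apply Rmult_le_compat_l.
    - replace (Rabs (scaled_weight n) * (INR (S n) * Rabs (x - y)))
        with (INR (S n) * Rabs (scaled_weight n) * Rabs (x - y)) by ring.
      replace (15 / 32 * Rabs (x - y) * (1 / 3) ^ n) with (15 / 32 * (1 / 3) ^ n * Rabs (x - y)) by ring.
      now apply Rmult_le_compat_r. }
  destruct (Series_geometric_le _ (1 / 3) _ ltac:(lra) Hb) as [He Hle].
  apply Rle_trans with (1 := Series_Rabs _ He). lra.
Qed.

Lemma scaled_slope_increasing (x y : R) : -1 < x -> x < y ->
  (x + 1) * dini_slope x < (y + 1) * dini_slope y.
Proof.
  intros Hx Hxy. pose proof (scaled_slope_near_identity y x ltac:(lra) Hx) as H.
  rewrite (Rabs_pos_eq (y - x)) in H by lra.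
  pose proof (Rle_abs (- ((y + 1) * dini_slope y - (x + 1) * dini_slope x - (y - x)))).
  rewrite Rabs_Ropp in *. lra.
Qed.

Lemma scaled_slope_continuous (x : R) : -1 < x ->
  continuity_pt (fun nu => (nu + 1) * dini_slope nu) x.
Proof.
  intros Hx eps Heps. exists (Rmin (x + 1) (eps / 2)). split.
  { apply Rmin_pos; lra. }
  intros y (_ & Hy). simpl in *. unfold R_dist in *.
  pose proof (Rmin_l (x + 1) (eps / 2)). pose proof (Rmin_r (x + 1) (eps / 2)).
  assert (Hy1 : -1 < y).
  { pose proof (Rle_abs (- (y - x))). rewrite Rabs_Ropp in *. lra. }
  pose proof (scaled_slope_near_identity y x Hy1 Hx) as H1.
  replace ((y + 1) * dini_slope y - (x + 1) * dini_slope x) with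
    (((y + 1) * dini_slope y - (x + 1) * dini_slope x - (y - x)) + (y - x)) by ring.
  apply Rle_lt_trans with (1 := Rabs_triang _ _). lra.
Qed.

Lemma dini_slope_truncation (nu : R) : 0 <= nu ->
  Rabs (dini_slope nu - sum_f_R0 (fun n => INR (S n) * dini_coef nu n) 4)
    <= 4 / 3 * Rabs (INR 6 * dini_coef nu 5).
Proof.
  intros Hnu. pose proof (is_series_dini_slope nu ltac:(lra)) as H.
  set (u := fun n => INR (S n) * dini_coef nu n) in *.
  rewrite <- (is_series_unique _ _ H).
  rewrite (Series_incr_n u 5) by (lia || (now exists (dini_slope nu))).
  simpl pred.
  replace (sum_f_R0 u 4 + Series (fun k => u (5 + k)%nat) - sum_f_R0 u 4)
    with (Series (fun k => u (5 + k)%nat)) by ring.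
  assert (Hb : forall n, 0 <= Rabs (u (5 + n)%nat) <= Rabs (u 5%nat) * (1 / 4) ^ n).
  { intros n. split; [apply Rabs_pos|]. induction n as [|n IH]; [simpl; lra|].
    apply Rle_trans with (1 / 4 * Rabs (u (5 + n)%nat)); [|simpl pow; lra].
    replace (5 + S n)%nat with (S (5 + n)) by lia. set (m := (5 + n)%nat).
    unfold u. rewrite !Rabs_mult, !(Rabs_pos_eq (INR _)) by apply pos_INR.
    pose proof (Rabs_dini_coef_S nu m ltac:(lra)) as Hr.
    assert (Hm : 2 <= INR m) by (apply INR_ge_2; unfold m; lia).
    rewrite !S_INR. set (x := INR m) in *.
    pose proof (Rabs_pos (dini_coef nu (S m))) as Hu. pose proof (Rabs_pos (dini_coef nu m)).
    set (p1 := Rabs (dini_coef nu (S m))) in *. set (p0 := Rabs (dini_coef nu m)) in *.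
    apply Rmult_le_reg_l with (2 * x + 3); [lra|].
    replace ((2 * x + 3) * (1 / 4 * ((x + 1) * p0))) with (1 / 4 * (x + 1) * ((2 * x + 3) * p0)) by ring.
    rewrite <- Hr.
    assert (Hmono : (2 * x + 1) * (4 * (x + 1) * (1 + x)) <= (2 * x + 1) * (4 * (x + 1) * (nu + 1 + x))).
    { apply Rmult_le_compat_l; [lra|]. apply Rmult_le_compat_l; lra. }
    assert (Hpoly : (2 * x + 3) * (x + 1 + 1)
      <= 1 / 4 * (x + 1) * ((2 * x + 1) * (4 * (x + 1) * (1 + x)))) by nra.
    assert ((2 * x + 3) * (x + 1 + 1)
      <= 1 / 4 * (x + 1) * ((2 * x + 1) * (4 * (x + 1) * (nu + 1 + x)))) by nra.
    assert ((2 * x + 3) * (x + 1 + 1) * p1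
      <= 1 / 4 * (x + 1) * ((2 * x + 1) * (4 * (x + 1) * (nu + 1 + x))) * p1)
      by (apply Rmult_le_compat_r; lra).
    lra. }
  destruct (Series_geometric_le _ (1 / 4) _ ltac:(lra) Hb) as [He Hle].
  apply Rle_trans with (1 := Series_Rabs _ He).
  change (u 5%nat) with (INR 6 * dini_coef nu 5) in Hle. lra.
Qed.

(** At this order and at the next one |r'(1)| exceeds 5 10^(-5), while the remainder after five
    terms is below 10^(-5). *)
Lemma dini_slope_neg_left : dini_slope (306 / 1000) < 0.
Proof.
  set (nu := 306 / 1000). assert (Hnu : 0 <= nu) by (unfold nu; lra).
  pose proof (dini_slope_truncation nu Hnu) as H.
  assert (E0 : dini_coef nu 0 = 1) by (apply dini_coef_0; lra).
  assert (E1 : dini_coef nu 1 = -375 / 653).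
  { rewrite dini_coef_S, E0 by lra. unfold nu. simpl INR. field. }
  assert (E2 : dini_coef nu 2 = 78125 / 1505818).
  { rewrite dini_coef_S, E1 by lra. unfold nu. simpl INR. field. }
  assert (E3 : dini_coef nu 3 = -13671875 / 7467351462).
  { rewrite dini_coef_S, E2 by lra. unfold nu. simpl INR. field. }
  assert (E4 : dini_coef nu 4 = 244140625 / 7145425643416).
  { rewrite dini_coef_S, E3 by lra. unfold nu. simpl INR. field. }
  assert (E5 : dini_coef nu 5 = -67138671875 / 170611328087843832).
  { rewrite dini_coef_S, E4 by lra. unfold nu. simpl INR. field. }
  simpl sum_f_R0 in H. rewrite E0, E1, E2, E3, E4, E5, (Rabs_left (INR 6 * _)) in H
    by (simpl INR; lra).
  simpl INR in H. apply Rabs_le_between in H. lra.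
Qed.

Lemma dini_slope_pos_right : 0 < dini_slope (3064 / 10000).
Proof.
  set (nu := 3064 / 10000). assert (Hnu : 0 <= nu) by (unfold nu; lra).
  pose proof (dini_slope_truncation nu Hnu) as H.
  assert (E0 : dini_coef nu 0 = 1) by (apply dini_coef_0; lra).
  assert (E1 : dini_coef nu 1 = -1875 / 3266).
  { rewrite dini_coef_S, E0 by lra. unfold nu. simpl INR. field. }
  assert (E2 : dini_coef nu 2 = 1953125 / 37663512).
  { rewrite dini_coef_S, E1 by lra. unfold nu. simpl INR. field. }
  assert (E3 : dini_coef nu 3 = -1708984375 / 933979770576).
  { rewrite dini_coef_S, E2 by lra. unfold nu. simpl INR. field. }
  assert (E4 : dini_coef nu 4 = 152587890625 / 4468989426676096).
  { rewrite dini_coef_S, E3 by lra. unfold nu. simpl INR. field. }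
  assert (E5 : dini_coef nu 5 = -19073486328125 / 48506411237142345984).
  { rewrite dini_coef_S, E4 by lra. unfold nu. simpl INR. field. }
  simpl sum_f_R0 in H. rewrite E0, E1, E2, E3, E4, E5, (Rabs_left (INR 6 * _)) in H
    by (simpl INR; lra).
  simpl INR in H. apply Rabs_le_between in H. lra.
Qed.

Theorem theorem2 :
  exists nustar : R,
    unique (fun nu : R =>
      0 < nu /\ bessel_J nu 1 - (3 - 2 * nu) * bessel_J (nu + 1) 1 = 0) nustar
    /\ Rabs (nustar - 3062 / 10000) < 2 / 10000
    /\ forall nu : R, -1 < nu ->
         ((starlike (dini_r nu) /\
           forall k : nat, (1 <= k)%nat ->
             close_to_convex (C_derive_n (dini_r nu) k))
          <-> nustar <= nu)
         /\ (nustar <= nu ->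
             forall k : nat, (1 <= k)%nat ->
               univalent (C_derive_n (dini_r nu) k)).
Proof.
  destruct (IVT_interv (fun nu => (nu + 1) * dini_slope nu) (306 / 1000) (3064 / 10000))
    as (s & Hs & Es).
  { intros x Hx. apply scaled_slope_continuous. lra. }
  { lra. }
  { pose proof dini_slope_neg_left. nra. }
  { pose proof dini_slope_pos_right. nra. }
  assert (Hs0 : dini_slope s = 0).
  { apply Rmult_integral in Es as [Es|Es]; [lra|exact Es]. }
  assert (Hsign : forall nu, -1 < nu -> (0 <= dini_slope nu <-> s <= nu)).
  { intros nu Hnu. split; intros H.
    - apply Rnot_lt_le. intros Hlt. pose proof (scaled_slope_increasing nu s Hnu Hlt).
      rewrite Hs0 in *. nra.
    - destruct H as [H| <-]; [|lra]. pose proof (scaled_slope_increasing s nu ltac:(lra) H).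
      rewrite Hs0 in *. nra. }
  assert (Hbessel : forall nu, -1 < nu ->
    (bessel_J nu 1 - (3 - 2 * nu) * bessel_J (nu + 1) 1 = 0 <-> dini_slope nu = 0)).
  { intros nu Hnu. rewrite bessel_combination by exact Hnu.
    assert (0 < Rpower (1 / 2) nu / Gamma (nu + 1)).
    { apply Rdiv_lt_0_compat; [apply exp_pos|apply Gamma_pos; lra]. }
    split; intros H'; [|rewrite H'; ring].
    apply Rmult_integral in H' as [H'|H']; lra. }
  exists s. split; [split|split].
  - split; [lra|]. apply Hbessel; lra.
  - intros nu [Hnu H]. apply Hbessel in H; [|lra].
    destruct (Rtotal_order s nu) as [Hlt|[E|Hlt]]; [|exact E|].
    + pose proof (scaled_slope_increasing s nu ltac:(lra) Hlt). rewrite Hs0, H in *. lra.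
    + pose proof (scaled_slope_increasing nu s ltac:(lra) Hlt). rewrite Hs0, H in *. lra.
  - assert (Hends : s <> 306 / 1000 /\ s <> 3064 / 10000).
    { pose proof dini_slope_neg_left. pose proof dini_slope_pos_right. split; intros E; rewrite E in Hs0; lra. }
    apply Rabs_def1; lra.
  - intros nu Hnu. rewrite dini_r_cps by exact Hnu.
    set (f := PS_incr_1 (dini_coef nu)).
    pose proof (dini_coef_entire nu Hnu) as Hp.
    assert (Hf : entire f) by now apply entire_PS_incr_1.
    split; [split|].
    + intros [[Huniv _] _]. apply Hsign; [exact Hnu|].
      apply (univalent_derivative_at_1 f Hf Huniv).
      change (0 < dini_coef nu 0). rewrite dini_coef_0 by exact Hnu. lra.
    + intros Hge. split.
      * apply starlike_criterion; [exact Hp| | |].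
        -- pose proof (dini_coef_S nu 0 Hnu) as E. rewrite dini_coef_0 in E by exact Hnu.
           rewrite E. simpl INR.
           assert (0 < (2 * 0 + 3) / ((2 * 0 + 1) * (4 * (0 + 1) * (nu + 1 + 0)))).
           { apply Rdiv_lt_0_compat; lra. }
           lra.
        -- apply dini_second_moment. lra.
        -- now apply Hsign.
      * intros k Hk. destruct (C_derive_n_cps f k Hf) as [Hfk ->].
        apply dominant_linear_close_to_convex; [exact Hfk|].
        apply dini_derivative_dominant; [lra|exact Hk].
    + intros Hge k Hk. destruct (C_derive_n_cps f k Hf) as [Hfk ->].
      apply dominant_linear_univalent; [exact Hfk|].
      apply dini_derivative_dominant; [lra|exact Hk].
Qed.
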